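(* Let $n\ge 2$ and let $s^*(r)=\max_{t,t'\in\mathcal{T}_n}\left[1-\frac{K_n^r(t,t')}{\pi_n(t')}\right]$ be the maximal separation distance after $r$ steps of the down-up chain $K_n$. (1) For $r\ge1$, \[ s^*(r)=\sum_{i=3}^{n-1}(-1)^{i-1}\frac{(2i-1)(i+1)(i-2)(n!)^2}{2n\,(n-i)!\,(n+i-1)!}\left(1-\frac{\binom{i}{2}}{\binom{n}{2}}\right)^r. \] (2) For fixed $c>0$, \[ \lim_{n\to\infty}s^*(cn^2)=\sum_{i=3}^{\infty}\frac{(-1)^{i-1}}{2}(2i-1)(i+1)(i-2)e^{-ci(i-1)}. \]
   Context: $\mathcal{T}_n$ denotes the set of rooted unlabeled trees on $n$ vertices (edges directed away from the root; a vertex is terminal if it has no children). For a vertex $v$ of $t$, $h(v)$ is the size of the subtree rooted at $v$; $m(t)=n!/\prod_{v\in t}h(v)$. The symmetry group is $SG(t)=\prod_{v\in t}SG(t,v)$, with $SG(t,v)$ generated by permutations exchanging isomorphic subtrees rooted at children of $v$; $n(t)=m(t)/|SG(t)|$. Write $s\nearrow t$ if $s$ is obtained from $t$ by deleting one terminal vertex. For $s\nearrow t$: $n(s,t)$ is the number of vertices of $s$ to which attaching a new terminal vertex yields $t$, and $m(s,t)$ is the number of terminal vertices of $t$ whose removal yields $s$. $\pi_n(t)=\frac{m(t)n(t)}{\prod_{i=2}^n\binom{i}{2}}=\frac{n\,2^{n-1}}{|SG(t)|\prod_{v}h(v)^2}$. Upward transition probabilities $P_u(s,t)=\frac{n(s,t)m(t)}{\binom{n}{2}m(s)}$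 ($s\in\mathcal{T}_{n-1}$, $t\in\mathcal{T}_n$, $s\nearrow t$; 0 otherwise); downward $P_d(t,s)=\frac{m(s,t)m(s)}{m(t)}$ ($s\nearrow t$; 0 otherwise). The down-up chain is $K_n(t,t')=\sum_{s\in\mathcal{T}_{n-1}}P_d(t,s)P_u(s,t')$, and $K_n^r$ is its $r$-step transition matrix. In part (2), $s^*(cn^2)$ is understood with $cn^2$ steps (for the chain on $\mathcal{T}_n$). *)

(* Defs.v *)
From HB Require Import structures.
From mathcomp Require Import all_boot all_order all_algebra all_fingroup.
From mathcomp Require Import generic_quotient.
From mathcomp Require Import all_classical all_reals all_analysis.
Set Implicit Arguments.
Unset Strict Implicit.
Unset Printing Implicit Defensive.
Import Order.TTheory GRing.Theory Num.Theory.
Import numFieldNormedType.Exports.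

(* Rooted unlabeled trees are obtained as the quotient of plane (ordered)     *)
(* rooted trees by the relation [iso] that forgets the order of the children. *)

Inductive ptree := PNode of seq ptree.

Definition children (t : ptree) : seq ptree := let: PNode ts := t in ts.

Definition leaf : ptree := PNode [::].

Lemma ptree_nest_ind (P : ptree -> Prop) :
  (forall ts, foldr (fun t Q => P t /\ Q) True ts -> P (PNode ts)) ->
  forall t, P t.
Proof.
move=> H; fix IH 1 => -[ts]; apply: H.
by elim: ts => [//|t ts IHts] /=; split; [exact: IH | exact: IHts].
Qed.

Fixpoint gtree_of_ptree (t : ptree) : GenTree.tree void :=
  let: PNode ts := t in GenTree.Node 0 (map gtree_of_ptree ts).

Fixpoint ptree_of_gtree (g : GenTree.tree void) : ptree :=
  match g with
  | GenTree.Leaf _ => leaf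
  | GenTree.Node _ gs => PNode (map ptree_of_gtree gs)
  end.

Lemma gtree_of_ptreeK : cancel gtree_of_ptree ptree_of_gtree.
Proof.
elim/ptree_nest_ind => ts IH /=; congr PNode.
by elim: ts IH => [//|t ts IHts] /= [-> /IHts ->].
Qed.

HB.instance Definition _ := Countable.copy ptree (can_type gtree_of_ptreeK).

Lemma ptree_ind_in (P : ptree -> Prop) :
  (forall ts, {in ts, forall t, P t} -> P (PNode ts)) -> forall t, P t.
Proof.
move=> H; elim/ptree_nest_ind => ts IH; apply: H => t.
elim: ts IH => [//|u ts IHts] /= [Pu /IHts {}IHts].
by rewrite inE => /predU1P[->|/IHts].
Qed.

Fixpoint iso (t u : ptree) : bool :=
  let: PNode ts := t in let: PNode us := u in
  has (fun vs => all2 iso ts vs) (permutations us).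

Lemma isoP ts us :
  reflect (exists2 vs, perm_eq vs us & all2 iso ts vs)
          (iso (PNode ts) (PNode us)).
Proof.
apply: (iffP hasP) => -[vs].
  by rewrite mem_permutations; exists vs.
by exists vs; rewrite ?mem_permutations.
Qed.

Lemma all2_perm (r : rel ptree) ts vs us : all2 r ts vs -> perm_eq us vs ->
  exists2 ws, perm_eq ws ts & all2 r ws us.
Proof.
rewrite all2E => /andP[/eqP szE /all_nthP allr].
move=> /(perm_iotaP leaf)[Is Isp ->].
exists (map (nth leaf ts) Is).
  by apply/(perm_iotaP leaf); exists Is; rewrite // szE.
have : {subset Is <= iota 0 (size vs)} by move=> i; rewrite (perm_mem Isp).
elim: Is {Isp} => [//|i Is IH] sub /=; apply/andP; split; last first.
  by apply: IH => j jIs; apply: sub; rewrite inE jIs orbT.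
have := sub i (mem_head _ _); rewrite mem_iota /= add0n => ilt.
have := allr (leaf, leaf) i; rewrite size_zip szE minnn => /(_ ilt).
by rewrite nth_zip.
Qed.

Lemma all2_swap (r : rel ptree) ts us :
  all2 r ts us = all2 (fun x y => r y x) us ts.
Proof. by elim: ts us => [|t ts IH] [|u us] //=; rewrite IH. Qed.

Lemma iso_refl : reflexive iso.
Proof.
elim/ptree_ind_in => ts IH; apply/isoP; exists ts => //.
elim: ts IH => [//|t ts IHts] IH /=; rewrite IH ?mem_head//=.
by apply: IHts => u uts; apply: IH; rewrite inE uts orbT.
Qed.

Lemma iso_imp_sym t u : iso t u -> iso u t.
Proof.
elim/ptree_ind_in: t u => ts IH [us] /isoP[vs pvs avs].
apply/isoP; have [|ws pws aws] := all2_perm avs (us := us).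
  by rewrite perm_sym.
exists ws => //; have : {subset ws <= ts} by move=> t; rewrite (perm_mem pws).
elim: ws us aws {pvs pws} => [|w ws IHws] [|u us] //= /andP[wu aws] sub.
rewrite IH ?sub ?mem_head//=; apply: IHws => // t tws.
by apply: sub; rewrite inE tws orbT.
Qed.

Lemma iso_sym : symmetric iso.
Proof. by move=> t u; apply/idP/idP; exact: iso_imp_sym. Qed.

Lemma iso_trans : transitive iso.
Proof.
move=> u t; elim/ptree_ind_in: t u => ts IH [us] [ws].
move=> /isoP[vs pvs avs] /isoP[xs pxs axs].
rewrite all2_swap in axs; have [ys pys ays] := all2_perm axs pvs.
apply/isoP; exists ys; first exact: perm_trans pys pxs.
rewrite all2_swap /= in ays.
elim: ts vs ys avs ays IH {pvs pys} => [|t ts IHts] [|v vs] [|y ys] //=.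
move=> /andP[tv avs] /andP[vy ays] IH; rewrite (IH t _ v)//= ?mem_head//.
by apply: (IHts vs) => // t' t'ts; apply: IH; rewrite inE t'ts orbT.
Qed.

Canonical iso_equiv := EquivRel iso iso_refl iso_sym iso_trans.

Definition rtree := {eq_quot iso}%qT.
HB.instance Definition _ := Choice.on rtree.
HB.instance Definition _ := EqQuotient.on rtree.
HB.instance Definition _ := Countable.copy rtree (can_type (@reprK _ rtree)).

(* A vertex is addressed by the path from the root leading to it: [[::]] is   *)
(* the root and [i :: v] is the vertex [v] of the subtree at the i-th child.  *)

Fixpoint pvertices (t : ptree) : seq (seq nat) :=
  let: PNode ts := t in
  [::] :: flatten [seq [seq iv.1 :: w | w <- iv.2]
                  | iv <- zip (iota 0 (size ts)) (map pvertices ts)].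

Fixpoint psubtree (t : ptree) (v : seq nat) : ptree :=
  if v is i :: w then psubtree (nth leaf (children t) i) w else t.

Definition psize (t : ptree) : nat := size (pvertices t).

Definition pterminal (t : ptree) (v : seq nat) : bool :=
  children (psubtree t v) == [::].

Fixpoint pattach (t : ptree) (v : seq nat) : ptree :=
  let ts := children t in
  if v is i :: w then PNode (set_nth leaf ts i (pattach (nth leaf ts i) w))
  else PNode (rcons ts leaf).

(* Deletion of the vertex [v], together with its descendants if there are     *)
(* any. The root cannot be deleted: [premove t [::] = t].                     *)
Fixpoint premove (t : ptree) (v : seq nat) : ptree :=
  let ts := children t in
  match v with
  | [::] => t
  | [:: i] => PNode (take i ts ++ drop i.+1 ts)
  | i :: w => PNode (set_nth leaf ts i (premove (nth leaf ts i) w))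
  end.


(* The constructions on plane trees used below do not depend, up to           *)
(* isomorphism, on the chosen representative [repr t] of [t : rtree].         *)
Section TreeStatistics.
Implicit Types s t : rtree.

Definition vertices t : seq (seq nat) := pvertices (repr t).

Definition tsize t : nat := size (vertices t).

Definition terminal t (v : seq nat) : bool := pterminal (repr t) v.

Definition hook t (v : seq nat) : nat := psize (psubtree (repr t) v).

Definition attach s (v : seq nat) : rtree := (\pi_rtree (pattach (repr s) v))%qT.

Definition remove t (v : seq nat) : rtree := (\pi_rtree (premove (repr t) v))%qT.

(* The root, which is terminal in the one-vertex tree, cannot be deleted. *)
Definition removable t (v : seq nat) : bool := (v != [::]) && terminal t v.

Definition covers s t : bool :=
  has (fun v => removable t v && (remove t v == s)) (vertices t).

Definition n_up s t : nat :=
  count (fun v => attach s v == t) (vertices s).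

Definition m_down s t : nat :=
  count (fun v => removable t v && (remove t v == s)) (vertices t).

Definition arity t (v : seq nat) : nat := size (children (psubtree (repr t) v)).

Definition child t (v : seq nat) (i : 'I_(arity t v)) : ptree :=
  nth leaf (children (psubtree (repr t) v)) i.

Definition SGv t (v : seq nat) : {group 'S_(arity t v)} :=
  <<[set tperm ij.1 ij.2 | ij : 'I_(arity t v) * 'I_(arity t v)
       & iso (child ij.1) (child ij.2)]%SET>>%G.

Definition SG t : {group {dffun forall v : seq_sub (vertices t),
                            'S_(arity t (ssval v))}} :=
  (setXn_group (fun v : seq_sub (vertices t) => SGv t (ssval v)))%G.

End TreeStatistics.

(* Plane trees with at most [d] vertices are found among [ptrees d]. *)
Fixpoint ptrees (d : nat) : seq ptree :=
  if d is d'.+1 then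
    [seq PNode ts | ts <-
       iter d' (fun S => [::] :: [seq t :: ts | t <- ptrees d', ts <- S])
            [:: [::]]]
  else [::].

Lemma psize_PNode ts : psize (PNode ts) = (sumn (map psize ts)).+1.
Proof.
rewrite /psize /= size_flatten /shape -map_comp; congr (sumn _).+1.
elim: ts 0 => [//|t ts IH] k /=; by rewrite size_map IH.
Qed.

Lemma psize_gt0 t : 0 < psize t.
Proof. by case: t => ts; rewrite psize_PNode. Qed.

Lemma mem_ptrees t d : psize t <= d -> t \in ptrees d.
Proof.
elim: d t => [|d IH] t; first by rewrite leqNgt psize_gt0.
case: t => ts; rewrite psize_PNode ltnS => szts /=.
apply: map_f; have {szts IH} : (size ts <= d) && all (mem (ptrees d)) ts.
  elim: ts szts => [//|t ts IHts] /= szts.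
  have t0 := psize_gt0 t.
  have /IHts/andP[_ ->] : sumn (map psize ts) <= d.
    exact: leq_trans (leq_addl _ _) szts.
  rewrite IH ?(leq_trans (leq_addr _ _) szts) //.
  rewrite andbT (leq_trans _ szts) {szts} // -add1n leq_add //.
  elim: ts {IHts} => [|u us IHus] //=; rewrite -add1n leq_add //.
  exact: psize_gt0.
move: (ptrees d) => S /andP[]; elim: d ts => [|k IHk] [|t ts] //=.
rewrite ltnS => szts /andP[tS tsS]; rewrite inE /=.
by apply/allpairsP; exists (t, ts); split=> //=; apply: IHk.
Qed.

Definition Tn (n : nat) : Type := {t : rtree | tsize t == n}.

HB.instance Definition _ n := [Countable of Tn n by <:].

Definition Tn_enum n : seq (Tn n) :=
  undup (pmap insub [seq (\pi_rtree t)%qT | t <- ptrees n]).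

Lemma Tn_enumP n : Finite.axiom (Tn_enum n).
Proof.
apply: Finite.uniq_enumP (undup_uniq _) _ => t.
rewrite mem_undup mem_pmap_sub; apply/mapP.
exists (repr (val t)); rewrite ?reprK //.
by apply: mem_ptrees; move/eqP: (valP t) => le_t; rewrite -[leqRHS]le_t.
Qed.

HB.instance Definition _ n := fintype.isFinite.Build (Tn n) (@Tn_enumP n).

Local Open Scope ring_scope.

Section DownUpChain.
Variable R : realType.

Definition m_tree (t : rtree) : R :=
  (tsize t)`!%:R / \prod_(v <- vertices t) (hook t v)%:R.

Definition n_tree (t : rtree) : R := m_tree t / #|SG t|%:R.

Definition pi_tree (t : rtree) : R :=
  m_tree t * n_tree t / \prod_(2 <= i < (tsize t).+1) 'C(i, 2)%:R.

Definition P_up (s t : rtree) : R :=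
  if covers s t then (n_up s t)%:R * m_tree t / ('C(tsize t, 2)%:R * m_tree s)
  else 0.

Definition P_down (t s : rtree) : R :=
  if covers s t then (m_down s t)%:R * m_tree s / m_tree t else 0.

Definition K (n : nat) (t t' : Tn n) : R :=
  \sum_(s : Tn n.-1) P_down (val t) (val s) * P_up (val s) (val t').

Definition K_mx (n : nat) : 'M[R]_#|{: Tn n}| :=
  \matrix_(i, j) K (enum_val i) (enum_val j).

Definition K_step (n r : nat) (t t' : Tn n) : R :=
  (K_mx n ^+ r) (enum_rank t) (enum_rank t').

Definition sep_values (n r : nat) : seq R :=
  [seq 1 - K_step r tt'.1 tt'.2 / pi_tree (val tt'.2) | tt' : Tn n * Tn n].

(* Seeding the iterated maximum with the first value makes it the maximum of  *)
(* the (nonempty) list of values, whatever their signs.                       *)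
Definition s_star (n r : nat) : R :=
  \big[Num.max/head 0 (sep_values n r)]_(x <- sep_values n r) x.

End DownUpChain.

(* Main.v *)
(** Let [U] and [D] act on functions of trees by summing over all ways of attaching,
    respectively deleting, a terminal vertex.  They satisfy [U D = D U + |t|], and up
    to conjugation by [m] and the factor [1 / C(n,2)] the down-up chain on trees of
    size [n] is [D U].  Normal ordering gives [(D U)^r = sum_k A(r,k) D^k U^k] with
    [A(r,k) >= 0], so every ratio [K_n^r(t,t') / pi_n(t')] is a combination, with
    nonnegative coefficients, of the numbers [D^k U^k delta_t' (t) / (m(t) n(t'))].
    For [k = n-1] and [k = n-2] these numbers are 1, as there is only one tree of size
    1 and one of size 2; for smaller [k] they vanish when [t] is a path and [t'] a
    star, which have no common subtree of size 3.  Hence the separation distance is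
    attained at this pair and depends only on [A(r,n-1) + A(r,n-2)].  The [A(r,k)] are
    divided differences of [x^r] at the nodes [C(n,2) - C(n-j,2)], which yields the
    explicit sum, and its limit follows by dominated convergence of series. *)
Require Import Defs.
From mathcomp Require Import all_boot all_order all_algebra all_fingroup.
From mathcomp Require Import generic_quotient.
From mathcomp Require Import all_classical all_reals all_analysis.
From mathcomp Require Import ring lra zify.
Set Implicit Arguments.
Unset Strict Implicit.
Unset Printing Implicit Defensive.
Import Order.TTheory GRing.Theory Num.Theory.
Import numFieldNormedType.Exports.
Local Notation cls p := (\pi_rtree p)%qT.

(** * Attaching and deleting vertices of plane trees *)

Lemma cls_eq p q : (cls p == cls q) = iso p q.
Proof. exact: eqmodE. Qed.

Lemma map_cls_all2 ts us : all2 iso ts us ->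
  map (fun t => cls t) ts = map (fun t => cls t) us.
Proof.
elim: ts us => [|t ts IH] [|u us] //= /andP[tu /IH ->].
by congr cons; apply/eqP; rewrite cls_eq.
Qed.

Lemma all2_iso_map_cls ts us :
  map (fun t => cls t) ts = map (fun t => cls t) us -> all2 iso ts us.
Proof.
elim: ts us => [|t ts IH] [|u us] //= [/eqP + /IH ->].
by rewrite cls_eq => ->.
Qed.

(** Matches the heads one at a time, removing a preimage from [us]. It turns equality of multisets
    of classes into the entrywise matching that [iso] asks for. *)
Lemma perm_map_lift (T T' : eqType) (f : T -> T') ts us :
  perm_eq (map f ts) (map f us) -> exists2 vs, perm_eq vs us & map f ts = map f vs.
Proof.
elim: ts us => [|t ts IH] us /=.
  by move=> /perm_size; rewrite size_map; case: us => // _; exists [::].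
move=> H; have : f t \in map f us by rewrite -(perm_mem H) mem_head.
case/mapP => u uus ftu.
have pu := perm_to_rem uus.
have : perm_eq (map f ts) (map f (rem u us)).
  rewrite -(perm_cons (f t)) (perm_trans H) // ftu -map_cons.
  exact: perm_map.
case/IH => vs pvs ->; exists (u :: vs); last by rewrite /= ftu.
by rewrite perm_sym (perm_trans pu) // perm_cons perm_sym.
Qed.

Lemma cls_PNode ts us : (cls (PNode ts) == cls (PNode us)) =
  perm_eq (map (fun t => cls t) ts) (map (fun t => cls t) us).
Proof.
rewrite cls_eq; apply/isoP/idP => [[vs pvs /map_cls_all2 ->]|].
  exact: perm_map.
by case/perm_map_lift => vs pvs E; exists vs => //; exact: all2_iso_map_cls.
Qed.

(** Induction principle for isomorphism invariants: it suffices that the value at a node be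
    determined by the multiset of classes and the multiset of values of the children. *)
Lemma iso_invariant (T : eqType) (phi : ptree -> T) :
  (forall ts us,
     perm_eq (map (fun t => cls t) ts) (map (fun t => cls t) us) ->
     perm_eq (map phi ts) (map phi us) -> phi (PNode ts) = phi (PNode us)) ->
  forall p q, iso p q -> phi p = phi q.
Proof.
move=> H; elim/ptree_ind_in => ts IH [us] iso_tu; move: (iso_tu).
rewrite -cls_eq cls_PNode => /H; apply.
case/isoP: iso_tu => vs pvs; move/(perm_map phi) : pvs => pvs E.
apply: perm_trans _ pvs; rewrite (_ : map phi ts = map phi vs) //.
elim: ts vs IH E => [|t ts IHt] [|v vs] //= IH /andP[tv tvs].
rewrite (IH t (mem_head _ _) v) //; congr cons; apply: IHt => // x xts.
by apply: IH; rewrite inE xts orbT.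
Qed.

Lemma repr_iso p : iso (repr (cls p)) p.
Proof. by rewrite -cls_eq reprK. Qed.

(* A local move [w] acting on one tree of a forest at a time: [w t] lists the *)
(* forests that may replace the tree [t]. *)
Fixpoint moves (w : ptree -> seq (seq ptree)) (ts : seq ptree) :=
  if ts is t :: us then
    [seq z ++ us | z <- w t] ++ [seq t :: vs | vs <- moves w us]
  else [::].

Definition ups p := map (pattach p) (pvertices p).

Definition downs p :=
  [seq premove p v | v <- pvertices p & (v != [::]) && pterminal p v].

Definition up_move t := [seq [:: u] | u <- ups t].

(** A leaf child disappears and leaves the empty forest. It needs its own case because [downs] never
    deletes a root, so [downs leaf] is empty. *)
Definition down_move t :=
  if t == leaf then [:: [::]] else [seq [:: u] | u <- downs t].

Lemma set_nth_size_cat (T : Type) (x0 : T) s1 y s2 z :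
  set_nth x0 (s1 ++ y :: s2) (size s1) z = s1 ++ z :: s2.
Proof. by elim: s1 => //= x s1 ->. Qed.

Lemma nth_size_cat (T : Type) (x0 : T) s1 y s2 :
  nth x0 (s1 ++ y :: s2) (size s1) = y.
Proof. by rewrite nth_cat ltnn subnn. Qed.

Lemma upsE ts : ups (PNode ts) =
  PNode (rcons ts leaf) :: map PNode (moves up_move ts).
Proof.
rewrite /ups /=; congr cons.
(* The prefix [ss] holds the children already passed, so that the index of the current child is
   [size ss] throughout the induction. *)
suff H ss : [seq pattach (PNode (ss ++ ts)) v | v <-
    flatten [seq [seq iv.1 :: w | w <- iv.2]
         | iv <- zip (iota (size ss) (size ts)) (map pvertices ts)]] =
    [seq PNode (ss ++ zs) | zs <- moves up_move ts] by exact: (H [::]).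
elim: ts ss => [|t ts IH] ss //=.
rewrite !map_cat; congr cat.
  rewrite /up_move -!map_comp; apply: eq_map => w /=.
  by rewrite nth_size_cat set_nth_size_cat.
rewrite -map_comp -cat_rcons -(size_rcons ss t) IH.
by apply: eq_map => zs /=; rewrite cat_rcons.
Qed.

Lemma leaf_eq p : (p == leaf) = (children p == [::]).
Proof. by apply/eqP/eqP => [->//|]; case: p => ts /= ->. Qed.

Lemma root_in_pvertices p :
  exists vs, pvertices p = [::] :: vs /\ all (fun v => v != [::]) vs.
Proof.
case: p => ts /=; eexists; split => //.
elim: ts 0 => [|t ts IH] k //=; rewrite all_cat IH andbT.
by apply/allP => v /mapP[w _ ->].
Qed.

Lemma downsE ts : downs (PNode ts) = map PNode (moves down_move ts).
Proof.
rewrite /downs /=.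
suff H ss : [seq premove (PNode (ss ++ ts)) v | v <-
    flatten [seq [seq iv.1 :: w | w <- iv.2]
         | iv <- zip (iota (size ss) (size ts)) (map pvertices ts)] &
     (v != [::]) && pterminal (PNode (ss ++ ts)) v] =
    [seq PNode (ss ++ zs) | zs <- moves down_move ts] by exact: (H [::]).
elim: ts ss => [|t ts IH] ss //=.
rewrite filter_cat !map_cat; congr cat; last first.
  rewrite -map_comp -cat_rcons -(size_rcons ss t) IH.
  by apply: eq_map => zs /=; rewrite cat_rcons.
rewrite filter_map -!map_comp.
rewrite /down_move /downs -/(pvertices t).
have [vs [tE /allP vs0]] := root_in_pvertices t; rewrite tE.
rewrite /= {1}/pterminal /= nth_size_cat -leaf_eq.
(* Strictly below the root of [t], deletion uses the recursive clause of [premove]; the one-element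
   path, which deletes [t] itself, is treated separately. *)
have E : {in [seq x <- vs | preim (cons (size ss)) (fun v => (v != [::]) &&
    pterminal (PNode (ss ++ t :: ts)) v) x],
   (premove (PNode (ss ++ t :: ts)) \o cons (size ss)) =1
   (fun v => PNode (ss ++ premove t v :: ts))}.
  move=> v; rewrite mem_filter => /andP[_ /vs0] /=; case: v => // a l _.
  by rewrite nth_size_cat set_nth_size_cat.
have F : [seq x <- vs | preim (cons (size ss)) (fun v => (v != [::]) &&
    pterminal (PNode (ss ++ t :: ts)) v) x] =
    [seq v <- vs | (v != [::]) && pterminal t v].
  apply: eq_in_filter => v /vs0 v0.
  by rewrite /= v0 /pterminal /= nth_size_cat.
case: eqP => [tl|tl] /=.
  have -> : vs = [::] by move: tE; rewrite tl => -[<-].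
  rewrite /= take_size_cat // -cat_rcons -(size_rcons ss t).
  by rewrite drop_size_cat.
rewrite (iffLR (eq_in_map _ _ _) E) F -!map_comp.
by apply: eq_map => v.
Qed.

Definition subtrees p := map (psubtree p) (pvertices p).

Lemma subtreesE ts : subtrees (PNode ts) = PNode ts :: flatten (map subtrees ts).
Proof.
rewrite /subtrees /=; congr cons.
suff H ss : [seq psubtree (PNode (ss ++ ts)) v | v <-
    flatten [seq [seq iv.1 :: w | w <- iv.2]
         | iv <- zip (iota (size ss) (size ts)) (map pvertices ts)]] =
    flatten (map subtrees ts) by exact: (H [::]).
elim: ts ss => [|t ts IH] ss //=.
rewrite map_cat; congr cat; last first.
  by rewrite -cat_rcons -(size_rcons ss t) IH.
by rewrite -map_comp; apply: eq_map => w /=; rewrite nth_size_cat.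
Qed.

Lemma uniq_pvertices p : uniq (pvertices p).
Proof.
elim/ptree_ind_in: p => ts IH /=; apply/andP; split.
  apply/negP; elim: ts 0 {IH} => [|t ts IH] k //=; rewrite mem_cat => /orP[|/IH//].
  by case/mapP.
elim: ts 0 IH => [|t ts IHts] k //= IH; rewrite cat_uniq map_inj_uniq; last by move=> ? ? [].
rewrite IH ?mem_head// IHts ?andbT /=; last first.
  by move=> u uts; apply: IH; rewrite inE uts orbT.
apply/hasP => -[v /flattenP[/= ws]].
case/mapP => -[i us] /= iu -> /mapP[w _ ->] /mapP[w' _ [ik _]].
have : i \in unzip1 (zip (iota k.+1 (size ts)) (map pvertices ts)).
  by apply/mapP; exists (i, us).
by rewrite unzip1_zip ?size_map ?size_iota // mem_iota ik ltnn.
Qed.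

Local Open Scope ring_scope.

(** * Sums over attachments and deletions *)

Lemma repr_ind (P : rtree -> Prop) : (forall p, P (cls p)) -> forall t, P t.
Proof. by move=> H t; rewrite -[t]reprK. Qed.

Lemma perm_rem (T : eqType) (x : T) (xs ys : seq T) :
  perm_eq xs ys -> perm_eq (rem x xs) (rem x ys).
Proof.
move=> pxy; have [xxs|xxs] := boolP (x \in xs); last first.
  by rewrite !rem_id // -(perm_mem pxy).
rewrite -(perm_cons x) -(permPl (perm_to_rem xxs)) (permPl pxy).
by rewrite perm_to_rem // -(perm_mem pxy).
Qed.

Section Moves.
Variables (V : nmodType) (w : ptree -> seq (seq ptree)).
Implicit Types (ts us : seq ptree).

Lemma sum_moves_cons (g : seq ptree -> V) t ts :
  \sum_(zs <- moves w (t :: ts)) g zs =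
  \sum_(z <- w t) g (z ++ ts) + \sum_(zs <- moves w ts) g (t :: zs).
Proof. by rewrite /= big_cat !big_map. Qed.

Lemma sum_moves1 (g : seq ptree -> V) t :
  \sum_(zs <- moves w [:: t]) g zs = \sum_(z <- w t) g z.
Proof.
rewrite sum_moves_cons big_nil addr0.
by apply: eq_bigr => z _; rewrite cats0.
Qed.

Lemma sum_moves_cat (g : seq ptree -> V) ts us :
  \sum_(zs <- moves w (ts ++ us)) g zs =
  \sum_(zs <- moves w ts) g (zs ++ us) + \sum_(zs <- moves w us) g (ts ++ zs).
Proof.
elim: ts g => [|t ts IH] g; first by rewrite big_nil add0r.
rewrite cat_cons !sum_moves_cons IH addrA; congr (_ + _ + _).
by apply: eq_bigr => z _; rewrite catA.
Qed.

(** As [F] ignores order, the forest left beside a moved tree counts only as a multiset: all the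
    classes, minus one copy of the class of that tree. Positions no longer occur. *)
Lemma sum_moves_rem (F : seq rtree -> V) ts :
  (forall xs ys, perm_eq xs ys -> F xs = F ys) ->
  \sum_(zs <- moves w ts) F (map (fun t => cls t) zs) =
  \sum_(t <- ts) \sum_(z <- w t)
    F (map (fun t => cls t) z ++ rem (cls t) (map (fun t => cls t) ts)).
Proof.
elim: ts F => [|t ts IH] F Fperm; first by rewrite !big_nil.
rewrite sum_moves_cons big_cons /= eqxx; congr (_ + _).
  by apply: eq_bigr => z _; rewrite map_cat.
rewrite (IH (fun zs => F (cls t :: zs))); last first.
  by move=> xs ys pxy; apply: Fperm; rewrite perm_cons.
apply: eq_big_seq => u uts; apply: eq_bigr => z _; apply: Fperm.
rewrite -cat1s perm_catCA perm_cat2l cat1s.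
case: eqP => [->|//]; rewrite perm_sym perm_to_rem //.
by apply/mapP; exists u.
Qed.

End Moves.

Section MoveInvariance.
Variables (V : nmodType).

Definition sum_ups (f : rtree -> V) (t : rtree) : V :=
  \sum_(q <- ups (repr t)) f (cls q).

Definition sum_downs (f : rtree -> V) (t : rtree) : V :=
  \sum_(q <- downs (repr t)) f (cls q).

Lemma sum_moves_iso (w : ptree -> seq (seq ptree)) (ts us : seq ptree)
    (F : seq rtree -> V) :
  (forall xs ys, perm_eq xs ys -> F xs = F ys) ->
  {in ts, forall t u, iso t u -> forall G : seq rtree -> V,
      \sum_(z <- w t) G (map (fun t => cls t) z) =
      \sum_(z <- w u) G (map (fun t => cls t) z)} ->
  perm_eq (map (fun t => cls t) ts) (map (fun t => cls t) us) ->
  \sum_(zs <- moves w ts) F (map (fun t => cls t) zs) =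
  \sum_(zs <- moves w us) F (map (fun t => cls t) zs).
Proof.
move=> Fp wi pts; rewrite !sum_moves_rem //.
(* [W] expresses the contribution of a tree through its class alone, so that the sum can be
   permuted. *)
pose W x := fun xs => \sum_(z <- w (repr x)) F (map (fun t => cls t) z ++ rem x xs).
transitivity (\sum_(x <- map (fun t => cls t) ts) W x (map (fun t => cls t) ts)).
  rewrite big_map; apply: eq_big_seq => t tts.
  have tr : iso t (repr (cls t)) by rewrite iso_sym repr_iso.
  by rewrite (wi _ tts _ tr (fun z => F (z ++ _))).
rewrite (perm_big _ pts) big_map /=; apply: eq_big_seq => u uus.
have /mapP[t tts ut] : cls u \in map (fun t => cls t) ts.
  by rewrite (perm_mem pts); apply/mapP; exists u.
have tu : iso t u by rewrite -cls_eq ut.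
have tr : iso t (repr (cls u)) by rewrite (iso_trans tu) // iso_sym repr_iso.
rewrite /W -(wi _ tts _ tr (fun z => F (z ++ _))) (wi _ tts _ tu (fun z => F (z ++ _))).
by apply: eq_bigr => z _; apply: Fp; rewrite perm_cat2l perm_rem.
Qed.

Lemma cls_PNode_perm (f : rtree -> V) ts us :
  perm_eq (map (fun t => cls t) ts) (map (fun t => cls t) us) ->
  f (cls (PNode ts)) = f (cls (PNode us)).
Proof. by rewrite -cls_PNode => /eqP ->. Qed.

(** Views [f] at a node as a symmetric function of the classes of its children, the form required by
    [sum_moves_iso]. *)
Definition on_classes (f : rtree -> V) (xs : seq rtree) : V :=
  f (cls (PNode (map repr xs))).

Lemma map_repr_cls xs : map (fun t => cls t) (map repr xs) = xs :> seq rtree.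
Proof. by rewrite -map_comp map_id_in // => x _ /=; rewrite reprK. Qed.

Lemma on_classesE f ts :
  f (cls (PNode ts)) = on_classes f (map (fun t => cls t) ts).
Proof. by apply: cls_PNode_perm; rewrite map_repr_cls. Qed.

Lemma on_classes_perm f xs ys :
  perm_eq xs ys -> on_classes f xs = on_classes f ys.
Proof. by move=> pxy; apply: cls_PNode_perm; rewrite !map_repr_cls. Qed.

Lemma sum_ups_iso p q : iso p q -> forall f : rtree -> V,
  \sum_(u <- ups p) f (cls u) = \sum_(u <- ups q) f (cls u).
Proof.
elim/ptree_ind_in: p q => ts IH [us] iso_tu f.
have ptu : perm_eq (map (fun t => cls t) ts) (map (fun t => cls t) us).
  by rewrite -cls_PNode cls_eq.
rewrite !upsE !big_cons !big_map; congr (_ + _).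
  by apply: cls_PNode_perm; rewrite !map_rcons -!cats1 perm_cat2r.
under eq_bigr do rewrite on_classesE; under [RHS]eq_bigr do rewrite on_classesE.
apply: sum_moves_iso => //; first exact: on_classes_perm.
move=> t tts u tu G; rewrite [LHS]big_map [RHS]big_map /=.
exact: (IH t tts u tu (fun x => G [:: x])).
Qed.

Lemma iso_leaf p : iso p leaf = (p == leaf).
Proof.
apply/idP/eqP => [|->]; last exact: iso_refl.
by case: p => ts /isoP[vs /perm_size/size0nil ->]; case: ts.
Qed.

Lemma sum_downs_iso p q : iso p q -> forall f : rtree -> V,
  \sum_(u <- downs p) f (cls u) = \sum_(u <- downs q) f (cls u).
Proof.
elim/ptree_ind_in: p q => ts IH [us] iso_tu f.
have ptu : perm_eq (map (fun t => cls t) ts) (map (fun t => cls t) us).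
  by rewrite -cls_PNode cls_eq.
rewrite !downsE !big_map.
under eq_bigr do rewrite on_classesE; under [RHS]eq_bigr do rewrite on_classesE.
apply: sum_moves_iso => //; first exact: on_classes_perm.
move=> t tts u tu G; rewrite /down_move -!iso_leaf.
have -> : iso t leaf = iso u leaf.
  by apply/idP/idP; apply: iso_trans => //; rewrite iso_sym.
case: ifP => // _; rewrite [LHS]big_map [RHS]big_map /=.
exact: (IH t tts u tu (fun x => G [:: x])).
Qed.

Lemma sum_ups_cls f p : sum_ups f (cls p) = \sum_(q <- ups p) f (cls q).
Proof. by apply: sum_ups_iso; exact: repr_iso. Qed.

Lemma sum_downs_cls f p : sum_downs f (cls p) = \sum_(q <- downs p) f (cls q).
Proof. by apply: sum_downs_iso; exact: repr_iso. Qed.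

End MoveInvariance.

(** Moves on two different trees of a forest commute, so the commutator comes only from pairs of
    moves on the same tree, and the defects add up. *)
Lemma sum_moves_comm (V : nmodType) (w1 w2 : ptree -> seq (seq ptree))
    (c : ptree -> nat) ts :
  {in ts, forall t (g : seq ptree -> V),
    \sum_(z <- w1 t) \sum_(y <- moves w2 z) g y =
    \sum_(z <- w2 t) \sum_(y <- moves w1 z) g y + g [:: t] *+ c t} ->
  forall g : seq ptree -> V,
    \sum_(z <- moves w1 ts) \sum_(y <- moves w2 z) g y =
    \sum_(z <- moves w2 ts) \sum_(y <- moves w1 z) g y
      + g ts *+ sumn (map c ts).
Proof.
elim: ts => [|t ts IH] H g; first by rewrite !big_nil mulr0n addr0.
have {}IH := IH (fun u uts => H u (@mem_behead _ (t :: ts) u uts)).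
rewrite !sum_moves_cons.
under eq_bigr do rewrite sum_moves_cat.
under [X in _ + X = _]eq_bigr do rewrite sum_moves_cons.
under [X in _ = X + _ + _]eq_bigr do rewrite sum_moves_cat.
under [X in _ = _ + X + _]eq_bigr do rewrite sum_moves_cons.
rewrite !big_split /= (IH (fun ys => g (t :: ys))).
rewrite (H t (mem_head _ _) (fun y => g (y ++ ts))) /= mulrnDr.
set A := \sum_(z <- w2 t) \sum_(y <- moves w1 z) _.
set B := \sum_(z <- moves w2 ts) \sum_(y <- moves w1 z) _.
rewrite [\sum_(z <- moves w1 ts) \sum_(y <- w2 t) _]exchange_big /=.
rewrite [\sum_(z <- moves w2 ts) \sum_(y <- w1 t) _]exchange_big /=.
set C := \sum_(z <- w1 t) _; set D := \sum_(z <- w2 t) _.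
rewrite -!addrA; congr (_ + _); rewrite [LHS]addrCA [RHS]addrCA.
by congr (_ + _); rewrite [LHS]addrCA; congr (_ + _); rewrite addrCA.
Qed.

(** The leaf attached to the root and then deleted again accounts for 1, and the children account
    for their sizes by [sum_moves_comm]; together this is the size of the tree. *)
Lemma ups_downs_comm (V : nmodType) p (g : ptree -> V) :
  \sum_(q <- ups p) \sum_(r <- downs q) g r =
  \sum_(q <- downs p) \sum_(r <- ups q) g r + g p *+ psize p.
Proof.
elim/ptree_ind_in: p g => ts IH g.
pose map_PNode := @big_map _ _ _ _ _ PNode.
rewrite upsE downsE big_cons downsE !map_PNode psize_PNode.
under [X in _ + X]eq_bigr do rewrite downsE map_PNode.
under [X in _ = X + _]eq_bigr do rewrite upsE big_cons map_PNode.
rewrite -cats1 sum_moves_cat big_split /=.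
rewrite (@sum_moves_comm _ up_move down_move psize) //; last first.
  move=> t tts h; rewrite big_map /down_move.
  under eq_bigr do rewrite sum_moves1 /down_move.
  (* For a leaf child, growing and then pruning restores it in exactly one way, while pruning first
     leaves an empty forest with nothing to grow on. *)
  case: (eqVneq t leaf) => [->|tl].
    by rewrite /= !big_seq1 /= big_nil add0r.
  pose map_seq1 := @big_map _ _ _ _ _ (fun u : ptree => [:: u]).
  rewrite map_seq1; under [X in _ = X + _]eq_bigr do rewrite sum_moves1 map_seq1.
  rewrite -(IH t tts (fun y => h [:: y])); apply: eq_big_seq => q.
  (* A tree grown by one vertex is not a leaf, so the special case of [down_move] cannot occur. *)
  move=> /mapP[v _ ->]; case: ifP; last by rewrite map_seq1.
  rewrite leaf_eq; case: t {tts tl} v => us [|i v] //=; first by case: us.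
  by rewrite -size_eq0 size_set_nth; lia.
rewrite /= big_seq1 cats0 mulrS.
under [X in _ = X + _ + _]eq_bigr do rewrite -cats1.
by rewrite -!addrA; congr (_ + _); rewrite addrCA.
Qed.

(** * Permutations preserving a coloring *)

Section ColorPreservingPermutations.
Variable T : eqType.

Definition color_perms n (c : 'I_n -> T) : {set 'S_n} :=
  [set s : 'S_n | [forall i, c (s i) == c i]]%SET.

Definition color_tperms n (c : 'I_n -> T) : {set 'S_n} :=
  [set tperm ij.1 ij.2 | ij : 'I_n * 'I_n & c ij.1 == c ij.2]%SET.

Lemma color_permsP n (c : 'I_n -> T) (s : 'S_n) :
  reflect (forall i, c (s i) = c i) (s \in color_perms c).
Proof.
by rewrite inE; apply: (iffP forallP) => H i; [apply/eqP | apply/eqP]; exact: H.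
Qed.

Lemma color_perms_group_set n (c : 'I_n -> T) : group_set (color_perms c).
Proof.
apply/group_setP; split; first by apply/color_permsP => i; rewrite perm1.
move=> s t /color_permsP Hs /color_permsP Ht; apply/color_permsP => i.
by rewrite permM Ht Hs.
Qed.

Canonical color_perms_group n (c : 'I_n -> T) := Group (color_perms_group_set c).

Lemma tperm_color_perms n (c : 'I_n -> T) i j :
  c i = c j -> tperm i j \in color_perms c.
Proof.
by move=> cij; apply/color_permsP => k; case: tpermP => [->|->|] //.
Qed.

(** Induction on the number of moved points: if [s] moves [i], following [s] by the transposition of
    [i] and [s i] fixes [i] as well and keeps all fixed points of [s]. *)
Lemma gen_color_tperms n (c : 'I_n -> T) :
  <<color_tperms c>>%G = color_perms c :> {set _}.
Proof.
apply/eqP; rewrite finset.eqEsubset gen_subG; apply/andP; split.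
  apply/fintype.subsetP => s /imsetP[[i j]]; rewrite inE /= => /eqP cij ->.
  exact: tperm_color_perms.
apply/fintype.subsetP => s.
have [m] := ubnP #|[set i | s i != i]%SET|; elim: m s => // m IH s.
rewrite ltnS => lem /color_permsP Hs.
have [[i si]|fix_s] := altP (@existsP _ (fun i => s i != i)); last first.
  suff -> : s = 1%g by exact: group1.
  apply/permP => i; rewrite perm1; apply/eqP; apply: contraNT fix_s => si.
  by apply/existsP; exists i.
have tG : tperm i (s i) \in <<color_tperms c>>%G.
  by rewrite mem_gen //; apply/imsetP; exists (i, s i); rewrite ?inE /= ?Hs.
rewrite -(groupMr _ tG); apply: IH; last first.
  apply/color_permsP => k; rewrite permM.
  by case: tpermP => [<-|/perm_inj ->|_ _]; rewrite ?Hs.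
apply: leq_trans lem; apply: proper_card; apply/fintype.properP; split; last first.
  by exists i; rewrite inE // permM tpermR eqxx.
apply/fintype.subsetP => k; rewrite !inE permM; apply: contra => /eqP sk.
rewrite sk; have [ki|ki] := eqVneq k i; first by rewrite -ki sk eqxx in si.
by rewrite tpermD // eq_sym // -{1}sk (inj_eq perm_inj).
Qed.

(** Orbit-stabilizer at position 0: its orbit is its color class, and its stabilizer consists of the
    color preserving permutations of the other positions, embedded by [lift_perm]. *)
Lemma card_color_perms n (c : 'I_n.+1 -> T) : #|color_perms c| =
  (#|[set i | c i == c ord0]%SET| * #|color_perms (c \o lift ord0)|)%N.
Proof.
rewrite -(card_orbit_stab 'P (color_perms_group c) ord0); congr (_ * _)%N.
  apply: eq_card => i; rewrite inE; apply/orbitP/eqP => [[s /color_permsP Hs <-]|ci].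
    exact: Hs.
  by exists (tperm ord0 i); [exact: tperm_color_perms | exact: tpermL].
have lift_perm_inj : injective (@lift_perm n ord0 ord0).
  move=> s t st; apply/permP => i; apply: (@lift_inj _ ord0).
  by rewrite -!(lift_perm_lift ord0) st.
rewrite -(card_imset _ lift_perm_inj); apply: eq_card => s.
apply/setIP/imsetP => [[/color_permsP Hs /astab1P s0]|[t /color_permsP Ht ->]].
  have {}s0 : s ord0 = ord0 := s0.
  pose g i := odflt i (unlift ord0 (s (lift ord0 i))).
  have gE i : lift ord0 (g i) = s (lift ord0 i).
    have nz : ord0 != s (lift ord0 i) by rewrite -{1}s0 (inj_eq perm_inj) neq_lift.
    by case/unlift_some: nz => j sj uj; rewrite /g uj.
  have g_inj : injective g.
    by move=> i j gij; apply/(@lift_inj _ ord0)/(@perm_inj _ s); rewrite -!gE gij.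
  exists (perm g_inj).
    by apply/color_permsP => i /=; rewrite permE gE.
  apply/permP => i; case: (unliftP ord0 i) => [j|] ->.
    by rewrite lift_perm_lift permE gE.
  by rewrite lift_perm_id.
split; last by apply/astab1P; exact: lift_perm_id.
apply/color_permsP => i; case: (unliftP ord0 i) => [j|] ->.
  by rewrite lift_perm_lift; exact: Ht.
by rewrite lift_perm_id.
Qed.
End ColorPreservingPermutations.

(** * Hooks and symmetries *)

Section SymmetryOrder.
Variable T : eqType.
Implicit Types xs ys : seq T.

(* The order of the group of permutations of the positions of [xs] that       *)
(* preserve its entries.                                                      *)
Fixpoint sym_order xs : nat :=
  if xs is x :: xs' then (count_mem x xs * sym_order xs')%N else 1%N.

Lemma sym_order_rem x xs :
  x \in xs -> sym_order xs = (count_mem x xs * sym_order (rem x xs))%N.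
Proof.
elim: xs => [//|y xs IH]; rewrite inE /=.
have [<-|xy] := eqVneq y x; first by rewrite eqxx.
rewrite /= => xxs; rewrite IH // add0n.
by rewrite count_rem xxs /= [x == y]eq_sym (negbTE xy) subn0 mulnCA.
Qed.

Lemma perm_sym_order xs ys : perm_eq xs ys -> sym_order xs = sym_order ys.
Proof.
elim: xs ys => [|x xs IH] ys pxy.
  by move: pxy; rewrite perm_sym => /perm_nilP ->.
have xys : x \in ys by rewrite -(perm_mem pxy) mem_head.
rewrite (sym_order_rem xys) /= -(IH (rem x ys)); last first.
  by rewrite -(perm_cons x) (perm_trans pxy) // perm_to_rem.
by move/seq.permP: pxy => <-.
Qed.

Lemma card_color_perms_seq (S : Type) (f : S -> T) (y0 : S) (ts : seq S) :
  #|color_perms (fun i : 'I_(size ts) => f (nth y0 ts i))| =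
  sym_order (map f ts).
Proof.
elim: ts => [|t ts IH].
  rewrite (_ : color_perms _ = [set 1%g]%SET) ?cards1 //.
  apply/setP => s; rewrite (permS0 s) finset.in_set1 eqxx.
  by apply/color_permsP => -[].
rewrite card_color_perms /= -IH; congr (_ * _)%N.
rewrite -sum1_card big_mkcond big_ord_recl /= inE eqxx; congr addn.
rewrite count_map -sum1_count [RHS]big_mkcond (big_nth y0) big_mkord /=.
by apply: eq_bigr => i _; rewrite inE.
Qed.

End SymmetryOrder.

Section TreeInvariants.
Implicit Types (p q : ptree).

Lemma mem_moves w ts zs : zs \in moves w ts ->
  exists s1 t s2 z, [/\ ts = s1 ++ t :: s2, z \in w t & zs = s1 ++ z ++ s2].
Proof.
elim: ts zs => [//|t ts IH] zs /=; rewrite mem_cat => /orP[]/mapP[z zw ->].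
  by exists [::], t, ts, z.
have [s1 [u [s2 [y [-> yw ->]]]]] := IH _ zw.
by exists (t :: s1), u, s2, y.
Qed.

Lemma psize_iso p q : iso p q -> psize p = psize q.
Proof.
apply: iso_invariant => ts us _ pE.
by rewrite !psize_PNode (perm_sumn pE).
Qed.

Lemma tsize_cls p : Defs.tsize (cls p) = psize p.
Proof. exact/psize_iso/repr_iso. Qed.

Lemma psize_ups p q : q \in ups p -> psize q = (psize p).+1.
Proof.
elim/ptree_ind_in: p q => ts IH q; rewrite upsE inE => /predU1P[->|].
  by rewrite !psize_PNode map_rcons sumn_rcons addn1.
case/mapP => zs /mem_moves[s1 [t [s2 [z [tsE zt ->]]]]] ->.
case/mapP: zt => u ut ->; rewrite !psize_PNode tsE !map_cat !sumn_cat /=.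
by rewrite (IH t _ u ut) ?tsE ?mem_cat ?mem_head ?orbT //=; lia.
Qed.

Lemma psize_downs p q : q \in downs p -> psize p = (psize q).+1.
Proof.
elim/ptree_ind_in: p q => ts IH q; rewrite downsE.
case/mapP => zs /mem_moves[s1 [t [s2 [z [tsE zt ->]]]]] ->.
move: zt; rewrite /down_move !psize_PNode tsE !map_cat !sumn_cat /=.
case: eqP => [->|_].
  by rewrite inE => /eqP -> /=; rewrite (_ : psize leaf = 1%N) //; lia.
case/mapP => u ut ->.
by rewrite (IH t _ u ut) ?tsE ?mem_cat ?mem_head ?orbT //=; lia.
Qed.

Section Hooks.
Variable R : realType.

Definition hooks p : R := \prod_(u <- subtrees p) (psize u)%:R.

Lemma hooksE ts :
  hooks (PNode ts) = (psize (PNode ts))%:R * \prod_(t <- ts) hooks t.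
Proof.
rewrite /hooks subtreesE big_cons; congr (_ * _).
by rewrite big_flatten big_map.
Qed.

Lemma hooks_gt0 p : 0 < hooks p.
Proof. by rewrite prodr_gt0 // => u _; rewrite ltr0n psize_gt0. Qed.

Lemma hooks_iso p q : iso p q -> hooks p = hooks q.
Proof.
suff H : iso p q -> (psize p, hooks p) = (psize q, hooks q) by case/H.
apply: (iso_invariant (phi := fun p => (psize p, hooks p))) => ts us _ pE.
rewrite !hooksE.
have /perm_sumn sE : perm_eq (map psize ts) (map psize us).
  have := perm_map fst pE; rewrite -!map_comp.
  by rewrite !(eq_map (_ : fst \o _ =1 psize)).
have hE : \prod_(t <- ts) hooks t = \prod_(t <- us) hooks t.
  rewrite -(big_map (fun p => (psize p, hooks p)) xpredT snd).
  by rewrite (perm_big _ pE) big_map.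
by rewrite !psize_PNode sE hE.
Qed.

Lemma m_tree_cls p : m_tree R (cls p) = (psize p)`!%:R / hooks p.
Proof.
rewrite /m_tree tsize_cls -(hooks_iso (repr_iso p)).
by rewrite /hooks /subtrees big_map.
Qed.

Lemma m_tree_gt0 t : 0 < m_tree R t.
Proof.
move: t; apply: repr_ind => p.
by rewrite m_tree_cls divr_gt0 ?hooks_gt0 // ltr0n fact_gt0.
Qed.

(** The hook length recursion in reciprocal form; multiplied by $(n-1)!$, with $n$ the size of the
    tree, it becomes the invariance of [m_tree] under summation over deletions. *)
Lemma sum_downs_hooks p : (1 < psize p)%N ->
  \sum_(q <- downs p) (hooks q)^-1 = (psize p)%:R / hooks p.
Proof.
elim/ptree_ind_in: p => ts IH; rewrite psize_PNode ltnS => ts0.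
(* Deletion acts on the product over a forest by the Leibniz rule, so each tree contributes its size
   as a factor; a leaf child contributes 1. *)
have E : \sum_(zs <- moves down_move ts) \prod_(z <- zs) (hooks z)^-1 =
    (sumn (map psize ts))%:R * \prod_(t <- ts) (hooks t)^-1.
  elim: ts IH {ts0} => [|t ts IHts] IH; first by rewrite /= big_nil mul0r.
  rewrite sum_moves_cons big_cons /= natrD mulrDl.
  under [X in _ + X]eq_bigr do rewrite big_cons.
  rewrite -mulr_sumr IHts; last by move=> u uts; apply: IH; rewrite inE uts orbT.
  rewrite mulrCA; congr (_ + _); rewrite mulrA.
  under eq_bigr do rewrite big_cat /=.
  rewrite -mulr_suml; congr (_ * _).
  rewrite /down_move; case: eqP => [->|tl].
    rewrite big_seq1 big_nil /hooks /subtrees /= big_seq1.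
    by rewrite (_ : psize leaf = 1%N) // mulfV ?oner_neq0.
  rewrite (big_map (fun u => [:: u])); under eq_bigr do rewrite big_seq1.
  apply: IH; first exact: mem_head.
  case: t tl => -[//|u us] _; rewrite psize_PNode ltnS /=.
  by rewrite ltn_addr // psize_gt0.
rewrite downsE (big_map PNode).
(* After any deletion the hook of the root is the total size of the original children. *)
transitivity (\sum_(zs <- moves down_move ts)
    (sumn (map psize ts))%:R^-1 * \prod_(z <- zs) (hooks z)^-1).
  apply: eq_big_seq => zs zsts.
  have /psize_downs : PNode zs \in downs (PNode ts) by rewrite downsE map_f.
  rewrite !psize_PNode => -[->]; rewrite hooksE psize_PNode invfM.
  by rewrite -prodfV.
rewrite -mulr_sumr E mulKf ?pnatr_eq0 -?lt0n //.
by rewrite hooksE invfM psize_PNode mulVKf ?pnatr_eq0 // prodfV.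
Qed.

Lemma sum_downs_m_tree t : (1 < Defs.tsize t)%N -> sum_downs (@m_tree R) t = m_tree R t.
Proof.
move: t; apply: repr_ind => p; rewrite tsize_cls sum_downs_cls m_tree_cls => p1.
under eq_bigr do rewrite m_tree_cls.
transitivity (\sum_(q <- downs p) (psize p).-1`!%:R * (hooks q)^-1).
  by apply: eq_big_seq => q /psize_downs ->.
rewrite -mulr_sumr sum_downs_hooks // mulrA -natrM mulnC.
by case: (psize p) p1 => // k _; rewrite factS.
Qed.

End Hooks.

Definition symmetries p : nat :=
  \prod_(u <- subtrees p) sym_order (map (fun t => cls t) (children u)).

Lemma symmetriesE ts : symmetries (PNode ts) =
  (sym_order (map (fun t => cls t) ts) * \prod_(t <- ts) symmetries t)%N.
Proof.
rewrite /symmetries subtreesE big_cons; congr (_ * _)%N.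
by rewrite big_flatten big_map.
Qed.

Lemma symmetries_iso p q : iso p q -> symmetries p = symmetries q.
Proof.
apply: iso_invariant => ts us pE sE; rewrite !symmetriesE (perm_sym_order pE).
by rewrite -(big_map symmetries xpredT id) (perm_big _ sE) big_map.
Qed.

Lemma card_SGv (t : rtree) v : #|SGv t v| =
  sym_order (map (fun t => cls t) (children (psubtree (repr t) v))).
Proof.
rewrite -(card_color_perms_seq _ leaf) -gen_color_tperms.
congr (#|pred_of_set (generated _)|); apply/setP => s.
by apply/imsetP/imsetP => -[ij ijP ->]; exists ij => //; move: ijP;
  rewrite !inE /child cls_eq.
Qed.

Lemma card_SG (t : rtree) : #|SG t| = symmetries (repr t).
Proof.
rewrite /SG /= cardsXn; under eq_bigr do rewrite card_SGv.
rewrite /symmetries /subtrees big_map -/(vertices t).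
pose F v := sym_order (map (fun t => cls t) (children (psubtree (repr t) v))).
rewrite -(big_map (fun v : seq_sub (vertices t) => ssval v) xpredT F).
apply: perm_big; apply: uniq_perm.
- by rewrite (map_inj_uniq val_inj) index_enum_uniq.
- exact: uniq_pvertices.
move=> v; apply/mapP/idP => [[[u uP] _ ->] //|vt].
by exists (SeqSub vt) => //; exact: mem_index_enum.
Qed.

End TreeInvariants.

(** * Duality between attachments and deletions *)

Section Duality.
Variable R : realType.
Implicit Types (x y : rtree) (xs ys : seq rtree).

(** The order of the symmetry group of a tree whose root has children of classes [xs]. *)
Definition weight xs : nat :=
  (sym_order xs * \prod_(x <- xs) #|SG x|)%N.

Lemma perm_weight xs ys : perm_eq xs ys -> weight xs = weight ys.
Proof. by move=> pxy; rewrite /weight (perm_sym_order pxy) (perm_big _ pxy). Qed.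

Lemma weight_rem x xs : x \in xs ->
  weight xs = (count_mem x xs * (#|SG x| * weight (rem x xs)))%N.
Proof.
move=> xxs; rewrite /weight (perm_big _ (perm_to_rem xxs)) big_cons.
by rewrite (sym_order_rem xxs) -!mulnA; congr (_ * _)%N; rewrite mulnCA.
Qed.

Lemma card_SG_cls p : #|SG (cls p)| = symmetries p.
Proof. by rewrite card_SG (symmetries_iso (repr_iso p)). Qed.

Lemma card_SG_PNode ts :
  #|SG (cls (PNode ts))| = weight (map (fun t => cls t) ts).
Proof.
rewrite card_SG_cls symmetriesE /weight big_map.
by under [in RHS]eq_bigr do rewrite card_SG_cls.
Qed.

(** Chooses which entry of [ys] plays the role of [x]; the number of choices is the multiplicity of
    [x] that [weight_rem] extracts from [weight ys]. *)
Lemma perm_cons_weight x xs ys :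
  (perm_eq (x :: xs) ys)%:R * (weight ys)%:R =
  \sum_(y <- ys) (x == y)%:R * (#|SG y|%:R * (weight xs)%:R)
                  * (perm_eq xs (rem y ys))%:R :> R.
Proof.
transitivity (\sum_(y <- ys | x == y) (#|SG x|%:R * (weight xs)%:R)
    * (perm_eq xs (rem x ys))%:R : R); last first.
  rewrite big_mkcond; apply: eq_bigr => y _.
  by case: eqP => [->|_]; rewrite ?mul1r ?mul0r.
have E : forall a : R, \sum_(y <- ys | x == y) a = (count_mem x ys)%:R * a.
  move=> a; rewrite big_const_seq iter_addr addr0 mulr_natl.
  by congr (_ *+ _); apply: eq_count => y /=; rewrite eq_sym.
rewrite {}E; have [xys|xys] := boolP (x \in ys).
  rewrite (weight_rem xys); have -> : perm_eq (x :: xs) ys = perm_eq xs (rem x ys).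
    by rewrite (permPr (perm_to_rem xys)) perm_cons.
  case: (boolP (perm_eq xs _)) => [pE|_]; last by rewrite !mulr0 mul0r.
  by rewrite -(perm_weight pE) !natrM mul1r mulr1.
rewrite (count_memPn xys) mul0r [perm_eq _ _](_ : _ = false) ?mul0r //.
by apply: contraNF xys => /perm_mem <-; exact: mem_head.
Qed.

Definition delta (t : rtree) x : R := (x == t)%:R.

(* Both sides count triples made of a forest of [x], a forest of [y] and a    *)
(* common remainder, so they are matched term by term.                        *)
Lemma sum_ups_delta (s t : rtree) :
  sum_ups (delta t) s * #|SG t|%:R = sum_downs (delta s) t * #|SG s|%:R.
Proof.
move: s t; apply: repr_ind => p; elim/ptree_ind_in: p => ts IH.
apply: repr_ind => -[us].
rewrite sum_ups_cls sum_downs_cls upsE downsE big_cons !(big_map PNode) !card_SG_PNode.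
set xs := map _ ts; set ys := map _ us.
have Fp (zs : seq rtree) : forall xs ys, perm_eq xs ys ->
    (perm_eq xs zs)%:R = (perm_eq ys zs)%:R :> R.
  by move=> x y pxy; rewrite (permPl pxy).
have dE vs ws : delta (cls (PNode ws)) (cls (PNode vs)) =
    (perm_eq (map (fun t => cls t) vs) (map (fun t => cls t) ws))%:R.
  by rewrite /delta cls_PNode.
under eq_bigr do rewrite dE; under [in RHS]eq_bigr do rewrite dE.
rewrite (sum_moves_rem _ _ (Fp _)) (sum_moves_rem _ _ (Fp _)) -/xs -/ys dE.
rewrite (@Fp ys _ (cls leaf :: xs)); last first.
  by rewrite map_rcons perm_rcons.
have mulr_sum2 (J I : Type) (r : seq I) (e : I -> seq J) (f : I -> J -> R) a :
    (\sum_(i <- r) \sum_(j <- e i) f i j) * a = \sum_(i <- r) \sum_(j <- e i) f i j * a.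
  by rewrite mulr_suml; apply: eq_bigr => i _; rewrite mulr_suml.
have step1 : (\sum_(t <- ts) \sum_(z <- up_move t)
      (perm_eq (map (fun t => cls t) z ++ rem (cls t) xs) ys)%:R) * (weight ys)%:R =
    \sum_(x <- xs) \sum_(y <- ys) sum_ups (delta y) x * #|SG y|%:R
       * ((weight (rem x xs))%:R * (perm_eq (rem x xs) (rem y ys))%:R) :> R.
  rewrite mulr_sum2 [RHS]big_map; apply: eq_bigr => t _.
  rewrite (big_map (fun u => [:: u])) /=.
  under eq_bigr do rewrite perm_cons_weight.
  rewrite exchange_big; apply: eq_bigr => y _.
  rewrite sum_ups_cls !mulr_suml; apply: eq_bigr => q _.
  by rewrite /delta !mulrA.
(* Deletion has an extra sum, where the deleted leaf is itself a child of the root; it is matched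
   afterwards with attaching a leaf to the root. *)
have step2 : (\sum_(t <- us) \sum_(z <- down_move t)
      (perm_eq (map (fun t => cls t) z ++ rem (cls t) ys) xs)%:R) * (weight xs)%:R =
    (\sum_(y <- ys) (y == cls leaf)%:R * (perm_eq (rem y ys) xs)%:R) * (weight xs)%:R +
    \sum_(x <- xs) \sum_(y <- ys) sum_downs (delta x) y * #|SG x|%:R
       * ((weight (rem y ys))%:R * (perm_eq (rem y ys) (rem x xs))%:R) :> R.
  rewrite exchange_big /= mulr_sum2 mulr_suml !big_map -big_split /=.
  apply: eq_bigr => u _.
  have -> : \sum_(x <- xs) sum_downs (delta x) (cls u) * #|SG x|%:R
       * ((weight (rem (cls u) ys))%:R * (perm_eq (rem (cls u) ys) (rem x xs))%:R) =
     \sum_(q <- downs u) (perm_eq (cls q :: rem (cls u) ys) xs)%:R * (weight xs)%:R :> R.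
    under [in RHS]eq_bigr do rewrite perm_cons_weight.
    rewrite exchange_big; apply: eq_bigr => x _.
    rewrite sum_downs_cls !mulr_suml; apply: eq_bigr => q _.
    by rewrite /delta !mulrA.
  rewrite cls_eq iso_leaf /down_move; case: eqP => [->|_].
    by rewrite big_seq1 /= big_nil addr0 mul1r.
  by rewrite !mul0r add0r (big_map (fun u => [:: u])).
rewrite mulrDl step1 step2 {step1 step2}; congr (_ + _).
  rewrite perm_cons_weight mulr_suml; apply: eq_bigr => y _.
  rewrite eq_sym [perm_eq xs _]perm_sym; case: eqP => [->|_]; last by rewrite !mul0r.
  by rewrite (card_SG_PNode [::]) /weight big_nil !mul1r mulrC.
rewrite {1}/xs [RHS]big_map big_map; apply: eq_big_seq => t tts.
apply: eq_bigr => y _; rewrite (IH t tts y) [in RHS]perm_sym.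
case: (boolP (perm_eq _ _)) => [pE|_]; last by rewrite !mulr0.
by rewrite (perm_weight pE).
Qed.

Lemma n_upE (s t : rtree) : (n_up s t)%:R = sum_ups (delta t) s.
Proof.
rewrite /n_up -sum1_count natr_sum big_mkcond /sum_ups /ups big_map.
by apply: eq_bigr => v _; rewrite /attach /delta; case: eqP.
Qed.

Lemma m_downE (s t : rtree) : (m_down s t)%:R = sum_downs (delta s) t.
Proof.
rewrite /m_down -sum1_count natr_sum /sum_downs /downs big_map big_filter.
rewrite big_mkcond [RHS]big_mkcond; apply: eq_bigr => v _.
rewrite /removable /terminal /remove /delta.
by case: (_ != _) => //=; case: pterminal => //=; case: eqP.
Qed.

Lemma coversE (s t : rtree) : covers s t = (0 < m_down s t)%N.
Proof. by rewrite /covers has_count. Qed.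

(** [covers] is defined through deletions; duality makes it follow from the existence of an
    attachment as well. *)
Lemma n_up_gt0_covers (s t : rtree) : (0 < n_up s t)%N -> covers s t.
Proof.
move=> n0; rewrite coversE -(ltr0n R) m_downE.
rewrite -(@pmulr_lgt0 _ #|SG s|%:R) ?ltr0n ?cardG_gt0 //.
by rewrite -sum_ups_delta -n_upE -natrM ltr0n muln_gt0 n0 cardG_gt0.
Qed.

End Duality.

(** * Normal ordering of the down-up operator *)

Section Operators.
Variable R : realType.
Implicit Types (f g : rtree -> R).

Local Notation U := (@sum_ups R).
Local Notation D := (@sum_downs R).

Lemma tsize_gt0 (t : rtree) : (0 < Defs.tsize t)%N.
Proof. exact: psize_gt0. Qed.

Lemma eq_sum_ups f g (t : rtree) :
  (forall s : rtree, Defs.tsize s = (Defs.tsize t).+1 -> f s = g s) -> U f t = U g t.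
Proof.
move=> fg; apply: eq_big_seq => q qt; apply: fg.
by rewrite tsize_cls (psize_ups qt).
Qed.

Lemma eq_sum_downs f g (t : rtree) :
  (forall s : rtree, Defs.tsize t = (Defs.tsize s).+1 -> f s = g s) -> D f t = D g t.
Proof.
move=> fg; apply: eq_big_seq => q qt; apply: fg.
by rewrite tsize_cls -(psize_downs qt).
Qed.

Lemma sum_upsZ (a : R) f (t : rtree) : U (fun x => a * f x) t = a * U f t.
Proof. by rewrite /sum_ups mulr_sumr. Qed.

Lemma sum_downsZ (a : R) f (t : rtree) : D (fun x => a * f x) t = a * D f t.
Proof. by rewrite /sum_downs mulr_sumr. Qed.

Lemma sum_ups_sum (I : Type) (r : seq I) (F : I -> rtree -> R) (t : rtree) :
  U (fun x => \sum_(i <- r) F i x) t = \sum_(i <- r) U (F i) t.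
Proof. exact: exchange_big. Qed.

Lemma sum_downs_sum (I : Type) (r : seq I) (F : I -> rtree -> R) (t : rtree) :
  D (fun x => \sum_(i <- r) F i x) t = \sum_(i <- r) D (F i) t.
Proof. exact: exchange_big. Qed.

Lemma sum_downsD f g (t : rtree) : D (fun x => f x + g x) t = D f t + D g t.
Proof. exact: big_split. Qed.

Lemma sum_ups_downs f (t : rtree) : U (D f) t = D (U f) t + f t *+ Defs.tsize t.
Proof.
move: t; apply: repr_ind => p; rewrite tsize_cls sum_ups_cls sum_downs_cls.
under eq_bigr do rewrite sum_downs_cls.
under [X in _ = X + _]eq_bigr do rewrite sum_ups_cls.
exact: (ups_downs_comm p (fun q => f (cls q))).
Qed.

(** For $k \le m+1$ this is $\binom{m+1}{2} - \binom{m+1-k}{2}$. *)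
Definition drop_sum (m k : nat) : nat := (\sum_(j < k) (m - j))%N.

(** Moving [U] past one [D] leaves the size of the current tree as a scalar, and this size drops by
    one with each [D] passed. *)
Lemma sum_ups_iter_downs k f (t : rtree) : U (iter k.+1 D f) t =
  iter k.+1 D (U f) t + (drop_sum (Defs.tsize t) k.+1)%:R * iter k D f t.
Proof.
elim: k t => [|k IH] t.
  by rewrite sum_ups_downs mulr_natl /drop_sum big_ord1 subn0.
rewrite [iter k.+2 D f]iterS sum_ups_downs.
rewrite (@eq_sum_downs _ (fun s => iter k.+1 D (U f) s +
    (drop_sum (Defs.tsize t).-1 k.+1)%:R * iter k D f s)); last first.
  by move=> s ->; rewrite IH.
rewrite sum_downsD sum_downsZ -addrA; congr (_ + _).
rewrite -[_ *+ Defs.tsize t]mulr_natl -mulrDl -natrD; congr (_%:R * _).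
rewrite /drop_sum [RHS]big_ord_recl subn0 addnC; congr addn.
by apply: eq_bigr => j _; rewrite lift0 -subn1 -subnDA add1n.
Qed.

Lemma iter_downs_eq0 k f (t : rtree) : (Defs.tsize t <= k)%N -> iter k D f t = 0.
Proof.
elim: k t => [|k IH] t; first by rewrite leqNgt tsize_gt0.
rewrite iterS => tk; rewrite (@eq_sum_downs _ (fun=> 0)).
  by rewrite /sum_downs big1.
by move=> s E; apply: IH; rewrite -ltnS -E.
Qed.

Section PowerExpansion.
Variable e : nat -> R.

(* [normal_coef r k] is the coefficient of [D^k U^k] in [(D U)^r].            *)
Fixpoint normal_coef (r k : nat) : R :=
  if r is r'.+1 then
    (if k is k'.+1 then normal_coef r' k' else 0) + e k * normal_coef r' k
  else (k == 0%N)%:R.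

End PowerExpansion.

Lemma normal_coef_ge0 (e : nat -> R) r k :
  (forall k, 0 <= e k) -> 0 <= normal_coef e r k.
Proof.
move=> e0; elim: r k => [|r IH] k /=; first by rewrite ler0n.
by rewrite addr_ge0 ?mulr_ge0 //; case: k.
Qed.

(** The inner [U] meets the powers of [D] on trees of size [n.-1], after the outer deletion; this is
    why the scalars are [drop_sum n.-1 k]. *)
Lemma down_up_power n r f (t : rtree) : Defs.tsize t = n ->
  iter r (D \o U) f t =
  \sum_(k < n) normal_coef (fun k => (drop_sum n.-1 k)%:R) r k *
               iter k D (iter k U f) t.
Proof.
elim: r t => [|r IH] t tn.
  have := tsize_gt0 t; rewrite tn; case: n {tn} => // n _.
  rewrite big_ord_recl /= mul1r big1 ?addr0 // => i _.
  by rewrite mul0r.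
pose c := normal_coef (fun k => (drop_sum n.-1 k)%:R) r.
transitivity (\sum_(k < n) c k * D (U (iter k D (iter k U f))) t).
  rewrite iterS /= (@eq_sum_downs _ (U (fun t => \sum_(k < n) c k *
      iter k D (iter k U f) t))); last first.
    by move=> s E; apply: eq_sum_ups => u us; apply: IH; rewrite us -E.
  rewrite (@eq_sum_downs _ (fun s => \sum_(k < n) c k * U (iter k D (iter k U f)) s)).
    by rewrite sum_downs_sum; apply: eq_bigr => k _; rewrite sum_downsZ.
  by move=> s _; rewrite sum_ups_sum; apply: eq_bigr => k _; rewrite sum_upsZ.
have step k : D (U (iter k D (iter k U f))) t = iter k.+1 D (iter k.+1 U f) t +
    (drop_sum n.-1 k)%:R * iter k D (iter k U f) t.
  case: k => [|k]; first by rewrite /drop_sum big_ord0 mul0r addr0.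
  rewrite (@eq_sum_downs _ (fun s => iter k.+1 D (iter k.+2 U f) s +
      (drop_sum n.-1 k.+1)%:R * iter k D (iter k.+1 U f) s)).
    by rewrite sum_downsD sum_downsZ.
  by move=> s E; rewrite sum_ups_iter_downs -tn E.
under eq_bigr do rewrite step mulrDr.
rewrite big_split /=.
under [X in _ = X]eq_bigr do rewrite mulrDl.
rewrite [RHS]big_split /=; congr (_ + _); last first.
  by apply: eq_bigr => k _; rewrite mulrA [c k * _]mulrC.
have := tsize_gt0 t; rewrite tn; move: tn; rewrite {}/c.
case: n {IH step} => // n tn _.
(* The shift creates a term with [n] deletions from a tree of size [n], which vanishes and keeps the
   range of [k] unchanged. *)
rewrite big_ord_recr [RHS]big_ord_recl /= mul0r add0r -iterS iter_downs_eq0 ?tn //.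
by rewrite mulr0 addr0.
Qed.

Lemma tsize1 (t : rtree) : Defs.tsize t = 1%N -> t = cls leaf.
Proof.
move: t; apply: repr_ind => -[[|u us]] //; rewrite tsize_cls psize_PNode /= => -[].
by have := psize_gt0 u; case: psize.
Qed.

Definition edge : ptree := PNode [:: leaf].

Lemma tsize2 (t : rtree) : Defs.tsize t = 2%N -> t = cls edge.
Proof.
move: t; apply: repr_ind => -[[|u us]]; rewrite tsize_cls psize_PNode // => -[] /=.
have := psize_gt0 u; case: us => [|v us] /=; last first.
  by move=> u0 E; have v0 := psize_gt0 v; exfalso; lia.
rewrite addn0 => _ u1; apply/eqP; rewrite cls_PNode /=.
by rewrite (@tsize1 (cls u)) // tsize_cls.
Qed.

Lemma m_tree_leaf : m_tree R (cls leaf) = 1.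
Proof.
by rewrite m_tree_cls /hooks /subtrees /= big_seq1 divff ?pnatr_eq0.
Qed.

Lemma m_tree_edge : m_tree R (cls edge) = 1.
Proof.
rewrite -sum_downs_m_tree ?tsize_cls // sum_downs_cls big_seq1.
exact: m_tree_leaf.
Qed.

Lemma iter_downs_pred n g (t : rtree) : Defs.tsize t = n.+1 ->
  iter n D g t = m_tree R t * g (cls leaf).
Proof.
elim: n t => [|n IH] t tn.
  by rewrite (tsize1 tn) m_tree_leaf mul1r.
rewrite iterS (@eq_sum_downs _ (fun s => g (cls leaf) * m_tree R s)).
  by rewrite sum_downsZ sum_downs_m_tree ?tn // mulrC.
move=> s; rewrite tn => /succn_inj/esym/IH ->; exact: mulrC.
Qed.

Lemma iter_downs_pred2 n g (t : rtree) : Defs.tsize t = n.+2 ->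
  iter n D g t = m_tree R t * g (cls edge).
Proof.
elim: n t => [|n IH] t tn.
  by rewrite (tsize2 tn) m_tree_edge mul1r.
rewrite iterS (@eq_sum_downs _ (fun s => g (cls edge) * m_tree R s)).
  by rewrite sum_downsZ sum_downs_m_tree ?tn // mulrC.
move=> s; rewrite tn => /succn_inj/esym/IH ->; exact: mulrC.
Qed.

Lemma sum_delta n f (x : rtree) : Defs.tsize x = n ->
  f x = \sum_(t : Tn n) delta R (val t) x * f (val t).
Proof.
move=> /eqP xn; rewrite (bigD1 (Sub x xn : Tn n)) //= /delta eqxx mul1r big1 ?addr0 //.
move=> t tx; case: eqP => [E|_]; last by rewrite mul0r.
by case/eqP: tx; apply: val_inj; rewrite /= E.
Qed.

Lemma sum_ups_Tn n f (s : rtree) : (Defs.tsize s).+1 = n ->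
  U f s = \sum_(t : Tn n) (n_up s (val t))%:R * f (val t).
Proof.
move=> sn; rewrite (@eq_sum_ups f (fun x => \sum_(t : Tn n) delta R (val t) x * f (val t))).
  rewrite sum_ups_sum; apply: eq_bigr => t _; rewrite n_upE mulrC -sum_upsZ.
  by apply: eq_bigr => q _; rewrite mulrC.
by move=> x; rewrite sn => /sum_delta.
Qed.

Lemma sum_downs_Tn n f (t : rtree) : Defs.tsize t = n.+1 ->
  D f t = \sum_(s : Tn n) (m_down (val s) t)%:R * f (val s).
Proof.
move=> tn; rewrite (@eq_sum_downs f (fun x => \sum_(s : Tn n) delta R (val s) x * f (val s))).
  rewrite sum_downs_sum; apply: eq_bigr => s _; rewrite m_downE mulrC -sum_downsZ.
  by apply: eq_bigr => q _; rewrite mulrC.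
by move=> x; rewrite tn => -[] /esym /sum_delta.
Qed.

Lemma card_SG_leaf : #|SG (cls leaf)| = 1%N.
Proof. by rewrite (card_SG_PNode [::]) /weight big_nil. Qed.

(** Dividing the invariance of [m_tree] under [D] by the symmetry order turns [m_down] into [n_up]
    by duality. *)
Lemma n_tree_sum n (t : rtree) : Defs.tsize t = n.+2 ->
  n_tree R t = \sum_(s : Tn n.+1) n_tree R (val s) * (n_up (val s) t)%:R.
Proof.
move=> tn; have SG0 (x : rtree) : #|SG x|%:R != 0 :> R.
  by rewrite pnatr_eq0 -lt0n cardG_gt0.
rewrite /n_tree -sum_downs_m_tree ?tn // (sum_downs_Tn _ tn) mulr_suml.
apply: eq_bigr => s _; rewrite n_upE m_downE.
have := sum_ups_delta R (val s) t => /(canRL (mulfK (SG0 _))) ->.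
move: (SG0 (val s)) (SG0 t); move: (#|SG (val s)|%:R : R) (#|SG t|%:R : R) => a b a0 b0.
by field; rewrite a0 b0.
Qed.

(** Consequently [n_tree] counts the ways to grow a tree from a single vertex by successive
    attachments. *)
Lemma iter_ups_leaf k f :
  iter k U f (cls leaf) = \sum_(t : Tn k.+1) n_tree R (val t) * f (val t).
Proof.
elim: k f => [|k IH] f.
  rewrite /= (@sum_delta 1 f) ?tsize_cls //; apply: eq_bigr => t _ /=.
  rewrite (tsize1 (eqP (valP t))) /delta eqxx /n_tree.
  by rewrite m_tree_leaf card_SG_leaf divr1.
rewrite iterSr IH.
under eq_bigr => s _ do rewrite (sum_ups_Tn f (congr1 S (eqP (valP s)))) mulr_sumr.
rewrite exchange_big; apply: eq_bigr => t _.
rewrite (n_tree_sum (eqP (valP t))) mulr_suml; apply: eq_bigr => s _.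
by rewrite mulrA.
Qed.

Lemma iter_ups_delta_leaf k (t : Tn k.+1) :
  iter k U (delta R (val t)) (cls leaf) = n_tree R (val t).
Proof.
rewrite iter_ups_leaf (bigD1 t) //= /delta eqxx mulr1 big1 ?addr0 // => s st.
by rewrite (inj_eq val_inj) (negbTE st) mulr0.
Qed.

(** The first attachment to a single vertex is forced, so starting from the edge gives the same
    count. *)
Lemma iter_ups_delta_edge k (t : Tn k.+2) :
  iter k U (delta R (val t)) (cls edge) = n_tree R (val t).
Proof.
by rewrite -iter_ups_delta_leaf iterS sum_ups_cls big_seq1.
Qed.

Lemma sum_ups_ge0 f : (forall t, 0 <= f t) -> forall t, 0 <= U f t.
Proof. by move=> f0 t; exact: sumr_ge0. Qed.

Lemma sum_downs_ge0 f : (forall t, 0 <= f t) -> forall t, 0 <= D f t.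
Proof. by move=> f0 t; exact: sumr_ge0. Qed.

Lemma iter_ge0 (F : (rtree -> R) -> rtree -> R) k f :
  (forall f, (forall t, 0 <= f t) -> forall t, 0 <= F f t) ->
  (forall t, 0 <= f t) -> forall t, 0 <= iter k F f t.
Proof. by move=> F0 f0; elim: k => [//|k IH] t; rewrite iterS; exact: F0. Qed.

Lemma n_tree_gt0 (t : rtree) : 0 < n_tree R t.
Proof. by rewrite divr_gt0 ?m_tree_gt0 // ltr0n cardG_gt0. Qed.

End Operators.

(** * The chain and its extremal pair *)

Section Chain.
Variable R : realType.

Local Notation U := (@sum_ups R).
Local Notation D := (@sum_downs R).

Lemma K_down_up n (t t' : Tn n) : (1 < n)%N -> K R t t' =
  (\sum_(s : Tn n.-1) (m_down (val s) (val t))%:R * (n_up (val s) (val t'))%:R) *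
  m_tree R (val t') / ('C(n, 2)%:R * m_tree R (val t)).
Proof.
move=> n1; rewrite /K !mulr_suml; apply: eq_bigr => s _.
have m0 (x : rtree) : m_tree R x != 0 by rewrite gt_eqF ?m_tree_gt0.
rewrite /P_down /P_up (eqP (valP t')).
case: ifPn => [_|]; last by rewrite coversE -leqNgt leqn0 => /eqP ->; rewrite !mul0r.
case: ifPn => [_|]; last first.
  move/(contraNN (@n_up_gt0_covers R _ _)); rewrite -leqNgt leqn0 => /eqP ->.
  by rewrite !(mulr0, mul0r).
have C0 : 'C(n, 2)%:R != 0 :> R by rewrite pnatr_eq0 -lt0n bin_gt0.
by field; rewrite C0 !m0.
Qed.

Lemma K_sum n (t : Tn n) (G : rtree -> R) : (1 < n)%N ->
  \sum_(t' : Tn n) K R t t' * G (val t') =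
  D (U (fun x => m_tree R x * G x)) (val t) / ('C(n, 2)%:R * m_tree R (val t)).
Proof.
move=> n1; have tn : Defs.tsize (val t) = n.-1.+1.
  by rewrite (eqP (valP t)) prednK // ltnW.
rewrite (sum_downs_Tn _ tn) mulr_suml.
under [RHS]eq_bigr => s _.
  rewrite (@sum_ups_Tn _ n); last by rewrite (eqP (valP s)) prednK // ltnW.
  rewrite mulr_sumr mulr_suml.
over.
rewrite exchange_big; apply: eq_bigr => t' _.
rewrite K_down_up // !mulr_suml; apply: eq_bigr => s _.
by rewrite !mulrA ![_ * G _]mulrC !mulrA.
Qed.

Lemma K_stepS n r (t t' : Tn n) :
  K_step R r.+1 t t' = \sum_(u : Tn n) K R t u * K_step R r u t'.
Proof.
rewrite /K_step exprS -mulmxE mxE (reindex enum_rank) /=.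
  by apply: eq_bigr => u _; rewrite !mxE !enum_rankK.
by exists enum_val => i _; rewrite ?enum_rankK ?enum_valK.
Qed.

Lemma K_step_down_up n r (t t' : Tn n) : (1 < n)%N ->
  K_step R r t t' = m_tree R (val t') / (m_tree R (val t) * 'C(n, 2)%:R ^+ r) *
    iter r (D \o U) (delta R (val t')) (val t).
Proof.
move=> n1; have m0 (x : rtree) : m_tree R x != 0 by rewrite gt_eqF ?m_tree_gt0.
have C0 : 'C(n, 2)%:R != 0 :> R by rewrite pnatr_eq0 -lt0n bin_gt0.
elim: r t => [|r IH] t.
  rewrite /K_step expr0 mxE /= /delta (inj_eq enum_rank_inj) (inj_eq val_inj) mulr1.
  by case: eqP => [->|_]; rewrite ?mulr0 // mulr1 divff.
rewrite K_stepS; under eq_bigr do rewrite IH.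
pose a : R := m_tree R (val t') / 'C(n, 2)%:R ^+ r.
rewrite (K_sum t (fun x => m_tree R (val t') / (m_tree R x * 'C(n, 2)%:R ^+ r) *
    iter r (D \o U) (delta R (val t')) x)) //.
rewrite (@eq_sum_downs _ _ (fun x => a * U (iter r (D \o U) (delta R (val t'))) x)).
  rewrite sum_downsZ iterS /= /a; move: (D _ _) => z.
  by rewrite exprS; field; rewrite C0 !m0 expf_neq0.
move=> s _; rewrite -sum_upsZ; apply: eq_sum_ups => u _; rewrite /a.
by field; rewrite m0 expf_neq0.
Qed.

Local Notation A n := (normal_coef (fun k => (drop_sum n.-1 k)%:R : R)).

Lemma K_step_pi n r (t t' : Tn n) : (1 < n)%N ->
  K_step R r t t' / pi_tree R (val t') =
  (\prod_(2 <= i < n.+1) 'C(i, 2)%:R) / 'C(n, 2)%:R ^+ r *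
  \sum_(k < n) A n r k * (iter k D (iter k U (delta R (val t'))) (val t) /
     (m_tree R (val t) * n_tree R (val t'))).
Proof.
move=> n1; rewrite K_step_down_up // (down_up_power _ _ (eqP (valP t))).
rewrite /pi_tree (eqP (valP t')) mulr_sumr mulr_suml [RHS]mulr_sumr.
apply: eq_bigr => k _.
have m0 (x : rtree) : m_tree R x != 0 by rewrite gt_eqF ?m_tree_gt0.
have n0 : n_tree R (val t') != 0 by rewrite gt_eqF ?n_tree_gt0.
have C0 : 'C(n, 2)%:R != 0 :> R by rewrite pnatr_eq0 -lt0n bin_gt0.
have P0 : \prod_(2 <= i < n.+1) 'C(i, 2)%:R != 0 :> R.
  rewrite prodf_seq_neq0; apply/allP => i; rewrite mem_index_iota => /andP[i2 _].
  by rewrite pnatr_eq0 -lt0n bin_gt0.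
by field; rewrite !m0 n0 P0 expf_neq0.
Qed.

Definition extremal_separation n r : R :=
  1 - (\prod_(2 <= i < n.+1) 'C(i, 2)%:R) / 'C(n, 2)%:R ^+ r *
    (A n r n.-1 + A n r n.-2).

Lemma K_step_pi_split n r (t t' : Tn n) : (1 < n)%N ->
  K_step R r t t' / pi_tree R (val t') =
  (\prod_(2 <= i < n.+1) 'C(i, 2)%:R) / 'C(n, 2)%:R ^+ r *
  (A n r n.-1 + A n r n.-2 +
   \sum_(k < n.-2) A n r k * (iter k D (iter k U (delta R (val t'))) (val t) /
     (m_tree R (val t) * n_tree R (val t')))).
Proof.
move=> n1; rewrite K_step_pi //; congr (_ * _); move: n1 t t'.
case: n => [//|[//|n]] _ t t'; rewrite !big_ord_recr /=.
rewrite [RHS]addrC -addrA; congr (_ + _); rewrite [RHS]addrC.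
have mn0 : m_tree R (val t) * n_tree R (val t') != 0.
  by rewrite mulf_neq0 // gt_eqF ?m_tree_gt0 ?n_tree_gt0.
rewrite -!iterS iter_downs_pred2 ?(eqP (valP t)) // iter_ups_delta_edge divff //.
by rewrite iter_downs_pred ?(eqP (valP t)) // iter_ups_delta_leaf divff // !mulr1.
Qed.

Lemma separation_le n r (t t' : Tn n) : (1 < n)%N ->
  1 - K_step R r t t' / pi_tree R (val t') <= extremal_separation n r.
Proof.
move=> n1; rewrite K_step_pi_split // lerD2l lerN2 ler_wpM2l //.
  by rewrite divr_ge0 ?exprn_ge0 // prodr_ge0.
rewrite lerDl sumr_ge0 // => k _; rewrite mulr_ge0 ?normal_coef_ge0 //.
apply: divr_ge0; last by rewrite mulr_ge0 // ltW ?m_tree_gt0 ?n_tree_gt0.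
apply: iter_ge0 => [f|x]; first exact: sum_downs_ge0.
apply: iter_ge0 => [f|y]; [exact: sum_ups_ge0 | exact: ler0n].
Qed.

(** * Paths and stars *)

Definition path_tree n : ptree := iter n (fun p => PNode [:: p]) leaf.

Definition star_tree n : ptree := PNode (nseq n leaf).

Lemma psize_path n : psize (path_tree n) = n.+1.
Proof. by elim: n => // n IH; rewrite psize_PNode /= IH addn0. Qed.

Lemma psize_star n : psize (star_tree n) = n.+1.
Proof. by rewrite psize_PNode map_nseq sumn_nseq mul1n. Qed.

Lemma downs_path n : downs (path_tree n.+1) = [:: path_tree n].
Proof.
elim: n => // n IH; rewrite [path_tree n.+2]/= downsE /= cats0 /down_move.
by rewrite ifF; [rewrite IH | apply/eqP].
Qed.

Lemma iter_downs_path k n f : (k <= n)%N ->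
  iter k D f (cls (path_tree n)) = f (cls (path_tree (n - k))).
Proof.
elim: k n => [|k IH] n; first by rewrite subn0.
by case: n => // n kn; rewrite iterS sum_downs_cls downs_path big_seq1 IH.
Qed.

(** Attachments preserve the existence of a child of the root that is not a leaf, and a star has no
    such child. *)
Lemma iter_ups_star n k p : has (fun t => t != leaf) (children p) ->
  iter k U (delta R (cls (star_tree n))) (cls p) = 0.
Proof.
elim: k p => [|k IH] [ts] /hasP[t tts tl].
  rewrite /= /delta /star_tree cls_PNode; case: (boolP (perm_eq _ _)) => //.
  move=> /perm_mem E; move: tl; rewrite -iso_leaf.
  have : cls t \in map (fun t => cls t) (nseq n leaf) by rewrite -E map_f.
  by rewrite map_nseq mem_nseq => /andP[_]; rewrite cls_eq => ->.
rewrite iterS sum_ups_cls big1_seq // => q /= qts; apply: IH.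
move: qts; rewrite upsE inE => /predU1P[->|/mapP[zs]].
  by apply/hasP; exists t => //; rewrite mem_rcons inE tts orbT.
case/mem_moves => s1 [u [s2 [z [_ /mapP[v vu ->] ->]]]] ->.
rewrite /= has_cat /=; apply/orP; right; apply/orP; left.
apply/eqP => vl; have := psize_ups vu; rewrite vl.
by have := psize_gt0 u; rewrite (_ : psize leaf = 1%N) //; case: psize.
Qed.

Lemma separation_attained n r : (1 < n)%N -> exists t t' : Tn n,
  1 - K_step R r t t' / pi_tree R (val t') = extremal_separation n r.
Proof.
move=> n1.
have pn : Defs.tsize (cls (path_tree n.-1)) == n.
  by rewrite tsize_cls psize_path prednK // ltnW.
have sn : Defs.tsize (cls (star_tree n.-1)) == n.
  by rewrite tsize_cls psize_star prednK // ltnW.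
exists (Sub (cls (path_tree n.-1)) pn : Tn n).
exists (Sub (cls (star_tree n.-1)) sn : Tn n).
rewrite K_step_pi_split // [\sum_(k < n.-2) _]big1 ?addr0 // => k _.
have kn := ltn_ord k; rewrite /= iter_downs_path; last by lia.
(* Since [k < n.-2], the remaining path has at least three vertices, so the child of its root is not
   a leaf. *)
have -> : (n.-1 - k)%N = (n.-1 - k).-2.+2 by lia.
by rewrite iter_ups_star ?mul0r ?mulr0 //= orbF; apply/eqP.
Qed.

(** The seed [head 0 s] is itself an entry of the nonempty list, hence bounded by [v]. *)
Lemma bigmax_attained (s : seq R) v : v \in s -> (forall x, x \in s -> x <= v) ->
  \big[Num.max/head 0 s]_(x <- s) x = v.
Proof.
move=> vs sv; apply/le_anti/andP; split; last exact: le_bigmax_seq.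
rewrite big_seq; apply: bigmax_le => [|x xs]; last exact: sv.
by apply: sv; case: s vs => //= a s _; exact: mem_head.
Qed.

Lemma s_starE n r : (1 < n)%N -> s_star R n r = extremal_separation n r.
Proof.
move=> n1; apply: bigmax_attained.
  have [t [t' <-]] := separation_attained r n1.
  by apply/mapP; exists (t, t'); rewrite ?mem_enum.
by move=> x /mapP[[t t'] _ ->]; exact: separation_le.
Qed.

End Chain.

(** * Divided differences *)

Section NodeProducts.
Variable R : fieldType.
Implicit Type e : nat -> R.

(** The Lagrange denominator at the node [e i] among [e 0], ..., [e (k-1)]. *)
Definition node_prod e (k i : nat) : R := \prod_(j < k | j != i :> nat) (e i - e j).

Lemma node_prodS e k i : (i < k)%N ->
  node_prod e k.+1 i = node_prod e k i * (e i - e k).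
Proof.
move=> ik; rewrite /node_prod big_mkcond big_ord_recr /= -big_mkcond.
by rewrite gtn_eqF.
Qed.

Lemma node_prod_last e k : node_prod e k.+1 k = \prod_(j < k) (e k - e j).
Proof.
rewrite /node_prod big_mkcond big_ord_recr /= eqxx mulr1.
by apply: eq_bigr => j _; rewrite ltn_eqF.
Qed.

Lemma node_prod_shift e k i :
  node_prod e k.+1 i.+1 = (e i.+1 - e 0%N) * node_prod (e \o S) k i.
Proof.
by rewrite /node_prod big_mkcond big_ord_recl /= -big_mkcond.
Qed.

Lemma prod_neq (F : nat -> R) n k : (k < n)%N ->
  \prod_(j < n) F j = F k * \prod_(j < n | j != k :> nat) F j.
Proof. by move=> kn; rewrite (bigD1 (Ordinal kn)). Qed.

Lemma node_prod_neq0 e k i : (i < k)%N ->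
  {in gtn k &, injective e} -> node_prod e k i != 0.
Proof.
move=> ik e_inj; apply/prodf_neq0 => j ji; rewrite subr_eq0.
by apply: contraNneq ji => /(e_inj _ _ ik (ltn_ord j)) ->.
Qed.

(** The divided difference of the constant 1 over at least two distinct nodes vanishes. The
    reduction [base] is the recurrence of divided differences, which lowers the number of nodes. *)
Lemma sum_node_prodV e k : {in gtn k.+2 &, injective e} ->
  \sum_(i < k.+2) (node_prod e k.+2 i)^-1 = 0.
Proof.
suff base m e' : {in gtn m.+2 &, injective e'} ->
    (e' m.+1 - e' 0%N) * \sum_(i < m.+2) (node_prod e' m.+2 i)^-1 =
    \sum_(i < m.+1) (node_prod (e' \o S) m.+1 i)^-1 -
    \sum_(i < m.+1) (node_prod e' m.+1 i)^-1.
  elim: k e => [|k IH] e e_inj; have := base _ e e_inj.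
    rewrite !big_ord1 !node_prod_last !big_ord0 subrr => /eqP.
    rewrite mulf_eq0 => /orP[|/eqP //].
    by rewrite subr_eq0 => /eqP/(e_inj 1%N 0%N isT isT).
  rewrite IH; last by by move=> i j ik jk /(e_inj i.+1 j.+1 ik jk)[].
  rewrite IH; last by move=> i j ik jk; exact: (e_inj _ _ (ltnW ik) (ltnW jk)).
  rewrite subrr => /eqP; rewrite mulf_eq0 => /orP[|/eqP //].
  by rewrite subr_eq0 => /eqP/(e_inj k.+2 0%N (ltnSn _) isT).
move=> e_inj; have nz i (im : (i < m.+2)%N) := node_prod_neq0 im e_inj.
(* Splits $e_{m+1} - e_0$ as $(e_i - e_0) - (e_i - e_{m+1})$; each difference cancels one factor of
   the denominator. *)
transitivity (\sum_(i < m.+2) (e' i - e' 0%N) / node_prod e' m.+2 i -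
              \sum_(i < m.+2) (e' i - e' m.+1) / node_prod e' m.+2 i).
  rewrite mulr_sumr -sumrB; apply: eq_bigr => i _.
  by rewrite -mulrBl; congr (_ * _); ring.
congr (_ - _).
  rewrite big_ord_recl subrr mul0r add0r; apply: eq_bigr => i _.
  have := nz (lift ord0 i) (ltn_ord _); rewrite lift0 node_prod_shift.
  by rewrite mulf_eq0 negb_or => /andP[n1 n2]; rewrite invfM mulVKf.
rewrite big_ord_recr /= subrr mul0r addr0; apply: eq_bigr => i _.
have := nz i (ltnW (ltn_ord i)); rewrite (node_prodS _ (ltn_ord i)).
by rewrite mulf_eq0 negb_or => /andP[n1 n2]; rewrite invfM mulrCA divff ?mulr1.
Qed.

End NodeProducts.

(** The right side is the divided difference of $x^r$ at $e_0, \dots, e_k$. The Leibniz rule for $x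
    \cdot x^r$ is the recurrence defining [normal_coef], and for $r = 0$ only $k = 0$ survives. *)
Lemma normal_coefE (R : realType) (e : nat -> R) r k :
  {in gtn k.+1 &, injective e} ->
  normal_coef e r k = \sum_(i < k.+1) e i ^+ r / node_prod e k.+1 i.
Proof.
elim: r k => [|r IH] k e_inj.
  under eq_bigr do rewrite expr0 mul1r.
  case: k e_inj => [|k] e_inj /=; last by rewrite sum_node_prodV.
  by rewrite big_ord1 node_prod_last big_ord0 invr1.
case: k e_inj => [|k] e_inj.
  by rewrite /= IH // !big_ord1 add0r exprS mulrA.
have e_inj' : {in gtn k.+1 &, injective e}.
  by move=> i j ik jk; exact: (e_inj _ _ (ltnW ik) (ltnW jk)).
rewrite /= !IH // [X in _ + _ * X]big_ord_recr [RHS]big_ord_recr /= mulrDr addrA.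
rewrite mulr_sumr -big_split /=.
congr (_ + _); last by rewrite exprS mulrA.
apply: eq_bigr => i _; rewrite (node_prodS _ (ltn_ord i)) exprS.
have := node_prod_neq0 (ltnW (ltn_ord i) : (i < k.+2)%N) e_inj.
rewrite (node_prodS _ (ltn_ord i)).
by rewrite mulf_eq0 negb_or => /andP[n1 n2]; field; rewrite n1 n2.
Qed.

(** * Explicit nodes and node products *)

Section ClosedForm.
Variable R : realType.

Lemma bin2R n : 'C(n, 2)%:R = n%:R * (n%:R - 1) / 2 :> R.
Proof.
elim: n => [|n IH]; first by rewrite mul0r mul0r.
by rewrite binS bin1 natrD IH -natr1; field.
Qed.

Lemma prod_bin2 n :
  \prod_(2 <= i < n.+2) 'C(i, 2)%:R = n.+1`!%:R * n`!%:R / 2 ^+ n :> R.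
Proof.
elim: n => [|n IH]; first by rewrite big_geq // !fact0 divr1 mulr1.
rewrite big_nat_recr //= IH bin2R !factS !natrM exprS -!natr1.
by field; rewrite expf_neq0.
Qed.

Lemma prod_subr_ffact N k : (k <= N)%N ->
  \prod_(j < k) (N%:R - j%:R) = N`!%:R / (N - k)`!%:R :> R.
Proof.
move=> kN; rewrite -(ffact_fact kN) natrM mulfK ?pnatr_eq0 -?lt0n ?fact_gt0 //.
rewrite ffact_prod natr_prod; apply: eq_bigr => j _.
by rewrite natrB // (leq_trans (ltnW (ltn_ord j))).
Qed.

Lemma node_prod_nat i k : node_prod (fun j => j%:R : R) (i + k).+1 i =
  (-1) ^+ k * i`!%:R * k`!%:R.
Proof.
elim: k => [|k IH].
  rewrite addn0 node_prod_last prod_subr_ffact // subnn fact0 divr1.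
  by rewrite expr0 mul1r mulr1.
rewrite addnS node_prodS ?IH ?ltnS ?leq_addr // factS exprS !natrM -addnS natrD.
by ring.
Qed.

Definition drop_node (n k : nat) : R := (drop_sum n.-1 k)%:R.

Lemma drop_nodeE n k : (k <= n)%N ->
  drop_node n.+1 k = k%:R * n%:R - k%:R * (k%:R - 1) / 2.
Proof.
rewrite /drop_node /drop_sum /=; elim: k => [|k IH] kn.
  by rewrite big_ord0 !mul0r subr0.
rewrite big_ord_recr natrD IH; last exact: ltnW.
by rewrite natrB ?(ltnW kn) // -[k.+1%:R]natr1; field.
Qed.

(** The node is the quadratic $k(2n+1-k)/2$, symmetric about $n + 1/2$, so differences split into
    linear factors and the node products into factorials. *)
Lemma drop_nodeB n k l : (k <= n)%N -> (l <= n)%N ->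
  drop_node n.+1 k - drop_node n.+1 l =
  (k%:R - l%:R) * ((n.*2 - k).+1%:R - l%:R) / 2.
Proof.
move=> kn ln; rewrite !drop_nodeE // -[(_ - k).+1%:R]natr1 natrB; last by lia.
by rewrite -mul2n natrM; field.
Qed.

Lemma drop_node_inj n : {in gtn n.+1 &, injective (drop_node n.+1)}.
Proof.
move=> k l; rewrite -!topredE /= => kn ln /eqP; rewrite !ltnS in kn ln.
rewrite -subr_eq0 drop_nodeB // !mulf_eq0 invr_eq0 pnatr_eq0 orbF.
rewrite !subr_eq0 !eqr_nat => /orP[/eqP //|/eqP E].
by lia.
Qed.

Lemma node_prod_drop i k : (0 < i)%N ->
  node_prod (drop_node (k + i)) (k + i) k =
  (-1) ^+ i.-1 * k`!%:R * (k + i + i - 1)`!%:R /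
    ((i.*2.-1)%:R * 2 ^+ (k + i).-1).
Proof.
case: i => // i _; rewrite ![(k + i.+1)%N]addnS doubleS [i.+1.-1]/= [_.+2.-1]/= [_.+1.-1]/=.
transitivity (node_prod (fun j => j%:R : R) (k + i).+1 k *
   \prod_(j < (k + i).+1 | j != k :> nat) (((k + i).*2 - k).+1%:R - j%:R)
   / 2 ^+ (k + i)).
  (* Counts the denominators 2: one for each index other than [k]. *)
  have := prod_neq (fun=> 2 : R) (leq_addr i k : (k < (k + i).+1)%N).
  have two0 : 2 != 0 :> R by rewrite pnatr_eq0.
  rewrite prodr_const card_ord exprS => /(mulfI two0) ->.
  rewrite /node_prod -big_split -prodf_div; apply: eq_bigr => j _ /=.
  by rewrite drop_nodeB ?leq_addr // -ltnS.
(* With the omitted factor [j = k] restored, the product is a falling factorial; that factor is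
   [i.*2.+1], the index [i] having been lowered by one. *)
have := prod_neq (fun j => ((k + i).*2 - k).+1%:R - j%:R : R)
  (leq_addr i k : (k < (k + i).+1)%N).
have -> : ((k + i).*2 - k).+1%N = (k + i.*2.+1)%N by lia.
rewrite prod_subr_ffact; last by lia.
have -> : (k + i.*2.+1)%:R - k%:R = i.*2.+1%:R :> R by rewrite natrD addrAC subrr add0r.
rewrite node_prod_nat.
have -> : (k + i.*2.+1 - (k + i).+1 = i)%N by lia.
have -> : ((k + i).+1 + i.+1 - 1 = k + i.*2.+1)%N by lia.
have fi : i`!%:R != 0 :> R by rewrite pnatr_eq0 -lt0n fact_gt0.
have i0 : i.*2.+1%:R != 0 :> R by rewrite pnatr_eq0.
move/(canLR (mulKf i0)) => <-; move: (i.*2.+1%:R : R) i0 => z i0.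
by field; rewrite fi i0 expf_neq0.
Qed.

End ClosedForm.

(** * The separation formula *)

Section SeparationFormula.
Variable R : realType.

Lemma drop_node_bin n i : (0 < i <= n)%N ->
  drop_node R n (n - i) = 'C(n, 2)%:R - 'C(i, 2)%:R.
Proof.
case: n => [|n] /andP[i0 i_n]; first by case: i i0 i_n.
rewrite drop_nodeE; last by lia.
by rewrite !bin2R natrB // -[n.+1%:R]natr1; field.
Qed.

(** The divided differences with $n$ and $n-1$ nodes are merged over the denominators of the former,
    with $i = n - k$. The ratio of denominators at node $k$ is $e_k - \binom{n}{2} = -\binom{i}{2}$,
    whence the factor $1 - \binom{i}{2}$. *)
Lemma extremal_separationE n r : (1 < n)%N ->
  extremal_separation R n r = - \sum_(2 <= i < n.+1)
    (\prod_(2 <= j < n.+1) 'C(j, 2)%:R) * (1 - 'C(i, 2)%:R / 'C(n, 2)%:R) ^+ r *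
    (1 - 'C(i, 2)%:R) / node_prod (drop_node R n) n (n - i).
Proof.
case: n => [//|[//|m]] _; rewrite /extremal_separation -/(drop_node R m.+2) /=.
set e := drop_node R m.+2; set C : R := 'C(m.+2, 2)%:R.
set P := \prod_(2 <= i < _) _.
have C0 : C != 0 by rewrite pnatr_eq0 -lt0n bin_gt0.
have e_last : e m.+1 = C by rewrite [LHS](@drop_node_bin m.+2 1) ?subr0.
have e_inj k : (k <= m.+2)%N -> {in gtn k &, injective e}.
  by move=> km i j ik jk; exact: (drop_node_inj (leq_trans ik km) (leq_trans jk km)).
(* This identity makes the contribution of the last node exactly 1, which cancels the 1 in the
   separation. *)
have P_last : P = node_prod e m.+2 m.+1.
  have := node_prod_drop R m.+1 (ltn0Sn 0); rewrite !addn1 subn1 -/e /= => ->.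
  by rewrite /P prod_bin2 expr0 !mul1r [m.+1`!%:R * _]mulrC.
rewrite (normal_coefE _ (e_inj _ (leqnn _))) (normal_coefE _ (e_inj _ (leqnSn _))).
rewrite big_ord_recr /= -P_last e_last.
have P0 : P != 0 by rewrite P_last; apply: node_prod_neq0 => //; exact: e_inj.
set S1 := \sum_(i < m.+1) _; set S2 := \sum_(i < m.+1) _.
have -> : 1 - P / C ^+ r * (S1 + C ^+ r / P + S2) = - (P / C ^+ r * (S1 + S2)).
  by field; rewrite P0 expf_neq0.
congr (- _); rewrite -big_split mulr_sumr -[2%N]add0n -[m.+3]addn2 big_addn addn2.
rewrite subSS subSS subn0 big_nat_rev big_mkord; apply: eq_bigr => k _ /=.
have km := ltn_ord k; have -> : (m.+2 - (0 + m.+1 - k.+1 + 2) = k)%N by lia.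
have eB : e k - C = - 'C(0 + m.+1 - k.+1 + 2, 2)%:R.
  have -> : e k = e (m.+2 - (0 + m.+1 - k.+1 + 2))%N by congr e; lia.
  by rewrite [e _]drop_node_bin; [ring | lia].
rewrite -[- 'C(_, _)%:R]eB; move/eqP: eB; rewrite subr_eq => /eqP eB.
have Pk : node_prod e m.+2 k != 0.
  by apply: node_prod_neq0; [lia | exact: e_inj].
move: Pk; rewrite node_prodS // e_last mulf_eq0 negb_or => /andP[Pk ek].
have -> : 1 - 'C(0 + m.+1 - k.+1 + 2, 2)%:R / C = e k / C.
  by rewrite eB; field.
by rewrite expr_div_n; field; apply/and3P; split=> //; exact: expf_neq0.
Qed.

Lemma s_star_sum n r : (1 < n)%N -> (0 < r)%N ->
  s_star R n r =
    \sum_(3 <= i < n)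
      (-1) ^+ (i - 1) *
      ((2 * i%:R - 1) * (i%:R + 1) * (i%:R - 2) * n`!%:R ^+ 2
       / (2 * n%:R * (n - i)`!%:R * (n + i - 1)`!%:R)) *
      (1 - 'C(i, 2)%:R / 'C(n, 2)%:R) ^+ r.
Proof.
move=> n1 r0; rewrite s_starE // extremal_separationE //.
pose F i : R := (\prod_(2 <= j < n.+1) 'C(j, 2)%:R) *
  (1 - 'C(i, 2)%:R / 'C(n, 2)%:R) ^+ r * (1 - 'C(i, 2)%:R) /
  node_prod (drop_node R n) n (n - i).
(* Both end terms vanish: [i = 2] because $\binom{2}{2} = 1$, and [i = n] because the power has base
   0 and exponent [r > 0]. *)
have F2 : F 2 = 0 by rewrite /F binn subrr mulr0 mul0r.
have Fn : F n = 0.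
  have C0 : 'C(n, 2)%:R != 0 :> R by rewrite pnatr_eq0 -lt0n bin_gt0.
  by rewrite /F (divff C0) subrr expr0n (gtn_eqF r0) mulr0 !mul0r.
transitivity (- \sum_(3 <= i < n) F i).
  congr (- _); rewrite -[LHS]/(\sum_(2 <= i < n.+1) F i).
  rewrite big_ltn // F2 add0r; move: n1; rewrite leq_eqVlt => /orP[/eqP <-|n2].
    by rewrite !big_geq.
  by rewrite big_nat_recr //= Fn addr0.
rewrite -sumrN; apply: eq_big_nat => i /andP[i3 i_n]; rewrite /F {F F2 Fn}.
have := node_prod_drop R (n - i) (leq_trans (isT : 0 < 3)%N i3).
rewrite subnK ?(ltnW i_n) // => ->; case: n n1 i_n => // m _ i_n.
rewrite prod_bin2 /= [in 1 - 'C(i, 2)%:R]bin2R factS natrM.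
have -> : i.-1 = (i - 1)%N by lia.
have -> : i.*2.-1%:R = 2 * i%:R - 1 :> R.
  rewrite -subn1 natrB; last by lia.
  by rewrite -mul2n natrM.
set s := (-1) ^+ (i - 1); set w := (1 - _) ^+ r.
have sV : s^-1 = s by rewrite /s invr_sign.
rewrite !invfM !invrK sV.
have f0 k : k`!%:R != 0 :> R by rewrite pnatr_eq0 -lt0n fact_gt0.
have n0 : m.+1%:R != 0 :> R by rewrite pnatr_eq0.
have x2 : 2 ^+ m != 0 :> R by rewrite expf_neq0.
move: (f0 (m.+1 + i - 1)%N) (f0 (m.+1 - i)%N) (f0 m) x2 n0.
move: (2 ^+ m) (m.+1%:R : R) => x N.
move: ((_ + i - 1)`!%:R : R) ((_ - i)`!%:R : R) (m`!%:R : R) => a b c a0 b0 c0 x0 N0.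
by field; rewrite a0 b0 x0 N0.
Qed.

End SeparationFormula.

(** * Dominated convergence of series *)

Local Open Scope classical_set_scope.

Section Tannery.
Variable R : realType.
Implicit Types (f : nat -> nat -> R) (a M : nat -> R).

Lemma sum_nat_series m a N :
  \sum_(m <= i < N) a i = series (fun i => if (m <= i)%N then a i else 0) N.
Proof. by rewrite /series /= (big_nat_widenl _ 0) //= big_mkcond. Qed.

Lemma cvg_sum_nat f a m N :
  (forall i, (m <= i)%N -> f n i @[n --> \oo] --> a i) ->
  \sum_(m <= i < N) f n i @[n --> \oo] --> \sum_(m <= i < N) a i.
Proof.
move=> fa; elim: N => [|N IH].
  by rewrite big_geq //; under eq_fun do rewrite big_geq //; exact: cvg_cst.
have [mN|Nm] := leqP m N; last first.
  by rewrite big_geq //; under eq_fun do rewrite big_geq //; exact: cvg_cst.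
rewrite big_nat_recr //=; under eq_fun do rewrite big_nat_recr //=.
by apply: cvgD => //; exact: fa.
Qed.

(** Tannery's theorem with a summation range growing with [n], so that domination is asked only for
    [i < n]. The sums are cut at an [N] beyond which the tail of [M] is small. *)
Lemma tannery f a M m :
  (forall i, 0 <= M i) -> cvgn (series M) ->
  (\forall n \near \oo, forall i, (m <= i < n)%N -> `|f n i| <= M i) ->
  (forall i, (m <= i)%N -> f n i @[n --> \oo] --> a i) ->
  cvgn (fun N => \sum_(m <= i < N) a i) /\
  \sum_(m <= i < n) f n i @[n --> \oo] --> limn (fun N => \sum_(m <= i < N) a i).
Proof.
move=> M0 cM fM fa.
have aM i : (m <= i)%N -> `|a i| <= M i.
  move=> mi; apply: (ler_cvg_to (cvg_norm (fa i mi)) (cvg_cst (M i))).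
  near=> n; have : forall i, (m <= i < n)%N -> `|f n i| <= M i by near: n.
  by apply; rewrite mi /=; near: n; exact: nbhs_infty_gt.
have ca : cvgn (fun N => \sum_(m <= i < N) a i).
  under eq_fun do rewrite sum_nat_series.
  apply: normed_cvg; apply: (series_le_cvg _ M0 _ cM) => i //=.
  by case: ifPn => [/aM //|_]; rewrite normr0.
split=> //; apply/cvgrPdist_lt => e e0.
(* Four errors are added: the limit against its partial sum, the heads up to [N], and the tails of
   [a] and of [f n]. *)
have e4 : 0 < e / 4 by rewrite divr_gt0.
move/cvgrPdist_lt/(_ _ e4): (ca) => La.
move/cvgrPdist_lt/(_ _ e4): (cM) => LM.
have [N [mN LMN]] : exists N, (m <= N)%N /\ limn (series M) - series M N < e / 4.
  near \oo => N; exists N; split; first by near: N; exact: nbhs_infty_ge.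
  by apply: le_lt_trans (ler_norm _) _; near: N.
have := cvg_sum_nat (N := N) fa; move/cvgrPdist_lt/(_ _ e4) => Lf.
near=> n.
have fMn : forall i, (m <= i < n)%N -> `|f n i| <= M i by near: n.
have Lan : `|limn (fun N => \sum_(m <= i < N) a i) - \sum_(m <= i < n) a i| < e / 4.
  by near: n.
have Lfn : `|\sum_(m <= i < N) a i - \sum_(m <= i < N) f n i| < e / 4.
  by near: n.
have Nn : (N <= n)%N by near: n; exact: nbhs_infty_ge.
have tail (u : nat -> R) : (forall i, (N <= i < n)%N -> `|u i| <= M i) ->
    `|\sum_(N <= i < n) u i| < e / 4.
  move=> uM; apply: le_lt_trans (ler_norm_sum _ _ _) _.
  apply: le_lt_trans LMN; apply: (@le_trans _ _ (\sum_(N <= i < n) M i)).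
    by apply: ler_sum_nat => i; exact: uM.
  rewrite -sub_series_geq // lerD2r nondecreasing_cvgn_le //.
  exact: nondecreasing_series.
have ta : `|\sum_(N <= i < n) a i| < e / 4.
  by apply: tail => i /andP[Ni _]; apply: aM; exact: leq_trans Ni.
have tf : `|\sum_(N <= i < n) f n i| < e / 4.
  by apply: tail => i /andP[Ni i_n]; apply: fMn; rewrite i_n (leq_trans mN).
move: Lan; rewrite (big_cat_nat mN Nn) /= [X in `|_ - X| < e](big_cat_nat mN Nn) /=.
move: Lfn ta tf; set L := limn _; rewrite !ltr_norml.
by move=> /andP[? ?] /andP[? ?] /andP[? ?] /andP[? ?]; apply/andP; split; lra.
Unshelve. all: by end_near.
Qed.

End Tannery.

(** * Asymptotics of the factorial weights *)

Section Limit.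
Variable R : realType.

(** For $0 < i \le n$ this is $\prod_{j=1}^{i-1} (n-j)/(n+j)$, which makes both the bound by 1 and
    the limit 1 visible. *)
Definition sep_weight (n i : nat) : R :=
  n`!%:R ^+ 2 / (n%:R * (n - i)`!%:R * (n + i - 1)`!%:R).

Lemma sep_weight1 n : (0 < n)%N -> sep_weight n 1 = 1.
Proof.
case: n => // n _; rewrite /sep_weight addnK subn1 /= factS natrM.
have n0 : n.+1%:R != 0 :> R by rewrite pnatr_eq0.
have f0 : n`!%:R != 0 :> R by rewrite pnatr_eq0 -lt0n fact_gt0.
by move: (n.+1%:R : R) n0 => N N0; field; rewrite N0 f0.
Qed.

Lemma sep_weightS n i : (0 < i < n)%N ->
  sep_weight n i.+1 = sep_weight n i * ((n - i)%:R / (n + i)%:R).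
Proof.
move=> /andP[i0 i_n]; rewrite /sep_weight.
have [p [p1 p2]] : exists p, (n - i = p.+1)%N /\ (n - i.+1 = p)%N.
  by exists (n - i.+1)%N; split; lia.
have [q [q1 q2 q3]] : exists q, [/\ n + i = q.+1, n + i.+1 - 1 = q.+1 & n + i - 1 = q]%N.
  by exists (n + i - 1)%N; split; lia.
rewrite p2 q2 q3 p1 q1 !factS !natrM.
have f0 k : k`!%:R != 0 :> R by rewrite pnatr_eq0 -lt0n fact_gt0.
have n0 k : k.+1%:R != 0 :> R by rewrite pnatr_eq0.
have nn0 : n%:R != 0 :> R by rewrite pnatr_eq0; lia.
move: (f0 p) (f0 q) (n0 p) (n0 q) nn0.
move: (n`!%:R : R) (p`!%:R : R) (q`!%:R : R) (p.+1%:R : R) (q.+1%:R : R) (n%:R : R).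
by move=> a b c d e N b0 c0 d0 e0 N0; field; rewrite ?b0 ?c0 ?d0 ?e0 ?N0.
Qed.

Lemma sep_weight_ge0 n i : 0 <= sep_weight n i.
Proof. by rewrite divr_ge0 ?mulr_ge0 ?exprn_ge0. Qed.

Lemma sep_weight_le1 n i : (0 < i <= n)%N -> sep_weight n i <= 1.
Proof.
elim: i => // i IH /andP[_ i_n]; have [->|i0] := posnP i.
  by rewrite sep_weight1 //; exact: leq_ltn_trans i_n.
rewrite sep_weightS ?i0 // -[leRHS]mulr1 ler_pM ?sep_weight_ge0 ?divr_ge0 //.
  by rewrite IH // i0 ltnW.
rewrite ler_pdivrMr ?ltr0n ?mul1r ?ler_nat; last by rewrite addn_gt0 i0 orbT.
by lia.
Qed.

Lemma cvg_sep_weight i : (0 < i)%N -> sep_weight n i @[n --> \oo] --> (1 : R).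
Proof.
elim: i => // i IH _; have [->|i0] := posnP i.
  apply: cvg_near_cst; near=> n; apply/eqP; rewrite sep_weight1 //.
  by near: n; exact: nbhs_infty_gt.
have lim1 : 1 - i.*2%:R * harmonic n @[n --> \oo] --> (1 : R).
  rewrite -[X in _ --> X]subr0 -[X in _ - X](mulr0 i.*2%:R).
  by apply: cvgB; [exact: cvg_cst | apply: cvgMl_tmp; exact: cvg_harmonic].
have limf : (n - i)%:R / (n + i)%:R @[n --> \oo] --> (1 : R).
  apply: (squeeze_cvgr _ lim1 (cvg_cst (1 : R))); near=> n.
  have i_n : (i < n)%N by near: n; exact: nbhs_infty_gt.
  have ni0 : 0 < (n + i)%:R :> R by rewrite ltr0n; lia.
  have n0 : 0 < n.+1%:R :> R by rewrite ltr0n.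
  apply/andP; split; last by rewrite ler_pdivrMr // mul1r ler_nat; lia.
  have -> : (n - i)%:R / (n + i)%:R = 1 - i.*2%:R / (n + i)%:R :> R.
    rewrite -[X in X - _](divff (lt0r_neq0 ni0)) -mulrBl -natrB; last by lia.
    by congr (_%:R / _); lia.
  rewrite lerD2l lerN2 ler_wpM2l // lef_pV2 ?posrE // ler_nat; lia.
rewrite -[X in _ --> X]mulr1.
apply: cvg_trans (cvgM (IH i0) limf); apply: near_eq_cvg; near=> n.
rewrite /= sep_weightS // i0; near: n; exact: nbhs_infty_gt.
Unshelve. all: by end_near.
Qed.

End Limit.

(** * The limit *)

Section PowerLimit.
Variables (R : realType) (c : R).
Hypothesis c0 : 0 < c.

Local Notation steps n := (Num.truncn (c * n%:R ^+ 2)).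

Definition sep_pow (n i : nat) : R := (1 - 'C(i, 2)%:R / 'C(n, 2)%:R) ^+ steps n.

Lemma bin2_ratio n i : 'C(i, 2)%:R / 'C(n, 2)%:R =
  i%:R * (i%:R - 1) / (n%:R * (n%:R - 1)) :> R.
Proof. by rewrite !bin2R invf_div mulrA divfK // mulrC; field. Qed.

Lemma bin2_ratio_itv n i : (i <= n)%N -> 0 <= ('C(i, 2)%:R / 'C(n, 2)%:R : R) <= 1.
Proof.
move=> i_n; rewrite divr_ge0 //=; have [->|C0] := posnP 'C(n, 2).
  by rewrite invr0 mulr0.
by rewrite ler_pdivrMr ?ltr0n // mul1r ler_nat leq_bin2l.
Qed.

Lemma sep_pow_ge0 n i : (i <= n)%N -> 0 <= sep_pow n i.
Proof.
by move=> /bin2_ratio_itv/andP[_ y1]; rewrite exprn_ge0 // subr_ge0.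
Qed.

(** Uses $1 - y \le e^{-y}$; truncation loses less than one step, and $cn^2 - 1 \ge cn(n-1)$ as soon
    as $cn \ge 1$. *)
Lemma sep_pow_le n i : (0 < i <= n)%N -> (1 < n)%N -> c^-1 <= n%:R ->
  sep_pow n i <= expR (- (c * i%:R * (i%:R - 1))).
Proof.
move=> /andP[i0 i_n] n1 cn; have /andP[_ y1] := bin2_ratio_itv i_n.
apply: (@le_trans _ _ (expR (- ('C(i, 2)%:R / 'C(n, 2)%:R)) ^+ steps n)).
  by rewrite lerXn2r ?nnegrE ?expR_ge0 ?subr_ge0 ?expR_ge1Dx.
rewrite -expRM_natl ler_expR mulrN lerN2 bin2_ratio.
have n1R : 1 < n%:R :> R by rewrite ltr1n.
have i1R : 1 <= i%:R :> R by rewrite ler1n.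
rewrite mulrA ler_pdivlMr; last by rewrite mulr_gt0 //; lra.
have -> : c * i%:R * (i%:R - 1) * (n%:R * (n%:R - 1)) =
    (c * (n%:R * (n%:R - 1))) * (i%:R * (i%:R - 1)) by ring.
apply: ler_wpM2r; first by rewrite mulr_ge0 //; lra.
have := truncnS_gt (c * n%:R ^+ 2); rewrite -natr1.
have : 1 <= c * n%:R by rewrite -ler_pdivrMl // mulr1.
by move=> h1 h2; nra.
Qed.

(** From $1 - y = (1 + y/(1-y))^{-1} \ge e^{-y/(1-y)}$ with $y = d/(n(n-1))$. The constants 8 and 9
    are chosen so that $n^2/(n(n-1)-d) \le 1 + 8/(n+1)$. *)
Lemma sep_pow_ge n i (d := i%:R * (i%:R - 1) : R) : (0 < i)%N -> d + 9 <= n%:R ->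
  expR (- (c * d * (1 + 8 * harmonic n))) <= sep_pow n i.
Proof.
move=> i0 dn; have i1R : 1 <= i%:R :> R by rewrite ler1n.
have d0 : 0 <= d by rewrite mulr_ge0 //; lra.
set N : R := n%:R in dn *.
have D0 : 0 < N * (N - 1) - d by nra.
rewrite /sep_pow bin2_ratio -/d -/N.
apply: (@le_trans _ _ (expR (- (d / (N * (N - 1) - d))) ^+ steps n)); last first.
  have e1 : 1 - d / (N * (N - 1)) = (1 + d / (N * (N - 1) - d))^-1.
    have N1 : 0 < N - 1 by lra.
    have N0 : 0 < N by lra.
    by field; rewrite !gt_eqF //=; nra.
  rewrite e1 expRN lerXn2r ?nnegrE ?invr_ge0 ?expR_ge0 //.
    by rewrite addr_ge0 // divr_ge0 // ltW.
  by rewrite lef_pV2 ?posrE ?expR_gt0 ?expR_ge1Dx // ltr_pwDl // divr_ge0 // ltW.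
rewrite -expRM_natl ler_expR mulrN lerN2 mulrA ler_pdivrMr //.
apply: (@le_trans _ _ (c * N ^+ 2 * d)).
  by apply: ler_wpM2r => //; rewrite truncn_le mulr_ge0 ?exprn_ge0 // ltW.
have -> : c * N ^+ 2 * d = c * d * N ^+ 2 by ring.
rewrite -[leRHS]mulrA; apply: ler_wpM2l; first by rewrite mulr_ge0 // ltW.
rewrite /harmonic /= -[n.+1%:R]natr1 -/N.
have N1 : 0 < N + 1 by lra.
have -> : (1 + 8 * (N + 1)^-1) * (N * (N - 1) - d) =
   (N + 9) * (N * (N - 1) - d) / (N + 1) by field; rewrite gt_eqF.
by rewrite ler_pdivlMr //; nra.
Qed.

Lemma cvg_sep_pow i : (0 < i)%N ->
  sep_pow n i @[n --> \oo] --> expR (- (c * i%:R * (i%:R - 1))).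
Proof.
move=> i0; pose d : R := i%:R * (i%:R - 1).
have lim : expR (- (c * d * (1 + 8 * harmonic n))) @[n --> \oo] -->
    expR (- (c * i%:R * (i%:R - 1))).
  apply: (continuous_cvg _ (@continuous_expR R _)).
  rewrite (_ : c * i%:R * (i%:R - 1) = c * d * (1 + 8 * 0)); last first.
    by rewrite /d; ring.
  apply: cvgN; apply: cvgMl_tmp; apply: cvgD; first exact: cvg_cst.
  by apply: cvgMl_tmp; exact: cvg_harmonic.
apply: (squeeze_cvgr _ lim (cvg_cst _)); near=> n.
rewrite sep_pow_ge //=; last by near: n; exact: nbhs_infty_ger.
apply: sep_pow_le; last by near: n; exact: nbhs_infty_ger.
  by rewrite i0 /=; near: n; exact: nbhs_infty_ge.
by near: n; exact: nbhs_infty_gt.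
Unshelve. all: by end_near.
Qed.

Definition sep_coef (i : nat) : R :=
  (-1) ^+ (i - 1) / 2 * (2 * i%:R - 1) * (i%:R + 1) * (i%:R - 2).

Lemma sep_coef_le i : (1 < i)%N -> `|sep_coef i| <= i%:R ^+ 3.
Proof.
move=> i1; have i2R : 2 <= i%:R :> R by rewrite ler_nat.
rewrite /sep_coef -!mulrA normrM normrX normrN1 expr1n mul1r.
rewrite ger0_norm; last by rewrite !mulr_ge0 //; lra.
by nra.
Qed.

(** From $x \le e^x$ at $x = ci/6$; after cubing, the polynomial costs $e^{ci/2}$, half of the
    available decay. *)
Lemma expR_cube_geometric i : i%:R ^+ 3 * expR (- (c * i%:R)) <=
  geometric ((6 / c) ^+ 3) (expR (- (c / 2))) i.
Proof.
rewrite /geometric /=.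
have le1 : i%:R <= 6 / c * expR (c * i%:R / 6).
  have h := expR_ge1Dx (c * i%:R / 6).
  rewrite [leLHS](_ : _ = 6 / c * (c * i%:R / 6)); last by field; rewrite gt_eqF.
  by apply: ler_wpM2l; [rewrite divr_ge0 // ltW | lra].
have le3 : i%:R ^+ 3 <= (6 / c) ^+ 3 * expR (c * i%:R / 2).
  have -> : c * i%:R / 2 = 3%:R * (c * i%:R / 6) by field.
  rewrite expRM_natl -exprMn lerXn2r ?nnegrE //.
  by rewrite mulr_ge0 ?expR_ge0 // divr_ge0 // ltW.
rewrite -expRM_natl; apply: le_trans (ler_wpM2r (expR_ge0 _) le3) _.
rewrite -[leLHS]mulrA -expRD le_eqVlt; apply/orP; left; apply/eqP.
by congr (_ * expR _); field.
Qed.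

End PowerLimit.

Theorem theorem4p3 (R : realType) :
  (forall n r : nat, (2 <= n)%N -> (1 <= r)%N ->
    s_star R n r =
    \sum_(3 <= i < n)
      (-1) ^+ (i - 1) *
      ((2 * i%:R - 1) * (i%:R + 1) * (i%:R - 2) * n`!%:R ^+ 2
       / (2 * n%:R * (n - i)`!%:R * (n + i - 1)`!%:R)) *
      (1 - 'C(i, 2)%:R / 'C(n, 2)%:R) ^+ r)
  /\
  (forall c : R, 0 < c ->
    let a (i : nat) : R :=
      (-1) ^+ (i - 1) / 2 * (2 * i%:R - 1) * (i%:R + 1) * (i%:R - 2)
      * expR (- (c * i%:R * (i%:R - 1))) in
    cvgn (fun N => \sum_(3 <= i < N) a i) /\
    s_star R n (Num.truncn (c * n%:R ^+ 2)) @[n --> \oo]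
      --> limn (fun N => \sum_(3 <= i < N) a i)).
Proof.
split=> [n r n2 r1|c c0 a]; first exact: s_star_sum.
pose f n i := sep_coef R i * (sep_weight R n i * sep_pow c n i).
have fle : \forall n \near \oo, forall i, (3 <= i < n)%N ->
    `|f n i| <= geometric ((6 / c) ^+ 3) (expR (- (c / 2))) i.
  near=> n => i /andP[i3 i_n].
  have i_itv : (0 < i <= n)%N by rewrite (ltnW i_n) andbT; exact: ltn_trans i3.
  have n1 : (1 < n)%N by near: n; exact: nbhs_infty_gt.
  have cn : c^-1 <= n%:R by near: n; exact: nbhs_infty_ger.
  apply: le_trans (expR_cube_geometric c0 i); rewrite normrM ler_pM //.
    by apply: sep_coef_le; exact: ltnW.
  have p0 := sep_pow_ge0 c (ltnW i_n).
  rewrite ger0_norm ?mulr_ge0 ?sep_weight_ge0 //.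
  apply: le_trans (_ : sep_pow c n i <= _).
    by rewrite ler_piMl // sep_weight_le1.
  apply: le_trans (sep_pow_le c0 i_itv n1 cn) _.
  have i3R : 3 <= i%:R :> R by rewrite ler_nat.
  (* The quadratic exponent is weakened to a linear one, as $i - 1 \ge 1$. *)
  rewrite ler_expR lerN2 ler_peMr ?mulr_ge0 ?(ltW c0) //; lra.
have flim i : (3 <= i)%N -> f n i @[n --> \oo] --> a i.
  move=> i3; have i0 : (0 < i)%N by exact: leq_trans i3.
  apply: cvgMl_tmp; rewrite -[X in _ --> X]mul1r.
  by apply: cvgM; [exact: cvg_sep_weight | exact: cvg_sep_pow].
have q1 : `|expR (- (c / 2))| < 1.
  by rewrite ger0_norm ?expR_ge0 // expR_lt1 oppr_lt0 divr_gt0.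
have M0 i : 0 <= geometric ((6 / c) ^+ 3) (expR (- (c / 2))) i.
  by rewrite /geometric /= mulr_ge0 ?exprn_ge0 ?expR_ge0 ?divr_ge0 ?(ltW c0).
have [ca lim] := tannery M0 (is_cvg_geometric_series q1) fle flim.
split=> //; apply: cvg_trans lim; apply: near_eq_cvg; near=> n.
have n1 : (1 < n)%N by near: n; exact: nbhs_infty_gt.
have cn : c^-1 <= n%:R by near: n; exact: nbhs_infty_ger.
(* The exact formula requires at least one step, which holds once $cn \ge 1$. *)
have r0 : (0 < Num.truncn (c * n%:R ^+ 2))%N.
  rewrite truncn_gt0; have : 1 <= c * n%:R by rewrite -ler_pdivrMl // mulr1.
  have : 1 < n%:R :> R by rewrite ltr1n.
  by move=> ? ?; nra.
rewrite s_star_sum //; apply: eq_big_nat => i _.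
rewrite /f /sep_coef /sep_weight /sep_pow !invfM; move: (_ ^+ Num.truncn _) => w.
by ring.
Unshelve. all: by end_near.
Qed.
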